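(* Let $n\ge 1$ and let $X$ be an $(n-1)$-connected, locally $(n-1)$-connected, semilocally $n$-connected, separable metric space, and let $x\in X$. Then $\pi_n(X,x)$ is countable.
   Context: A space is $m$-connected ($m\ge 0$) if it is path connected and its homotopy groups $\pi_k$ are trivial for $1\le k\le m$. A space $X$ is locally $m$-connected ($m\ge 0$) if for each $x\in X$ and each neighborhood $U$ of $x$ there is a neighborhood $V\subseteq U$ of $x$ such that the inclusion-induced map $\pi_k(V)\to\pi_k(U)$ is trivial for all $0\le k\le m$ and all base points in $V$. A space $X$ is semilocally $n$-connected at $x$ if there is an open neighborhood $U$ of $x$ such that the inclusion-induced homomorphism $\pi_n(U,x)\to\pi_n(X,x)$ is trivial; it is semilocally $n$-connected if this holds at every $x\in X$. *)

(* Defs.v *)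
From HB Require Import structures.
From mathcomp Require Import all_boot all_order generic_quotient all_algebra.
From mathcomp Require Import all_classical all_reals all_analysis.

Set Implicit Arguments.
Unset Strict Implicit.
Unset Printing Implicit Defensive.

Import Order.TTheory GRing.Theory Num.Theory.
Import numFieldNormedType.Exports.

Local Open Scope classical_set_scope.
Local Open Scope ring_scope.
Local Open Scope quotient_scope.

(* Subsets used as types (the unit interval, the cube, neighborhoods) are the
   sigma types [set_type], which carry the subspace topology. *)

Definition unit_itv (R : realType) : set R := `[0, 1].
Arguments unit_itv : clear implicits.

Definition cube (R : realType) (n : nat) : set 'rV[R]_n :=
  [set u | forall i, 0 <= u ord0 i <= 1].
Arguments cube : clear implicits.

(* Empty when [n = 0], so that the definitions below also give pi_0. *)
Definition cube_boundary (R : realType) (n : nat) : set (cube R n) :=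
  [set u : cube R n | let v : 'rV[R]_n := \val u in
     exists i, v ord0 i = 0 \/ v ord0 i = 1].

Record nloop (R : realType) (n : nat) (X : topologicalType) (x : X) := NLoop {
  nloop_fun :> cube R n -> X;
  nloop_continuous : continuous nloop_fun;
  nloop_boundary : forall u, cube_boundary u -> nloop_fun u = x
}.

HB.instance Definition _ (R : realType) (n : nat) (X : topologicalType)
  (x : X) := gen_eqMixin (nloop R n x).
HB.instance Definition _ (R : realType) (n : nat) (X : topologicalType)
  (x : X) := gen_choiceMixin (nloop R n x).

(* Homotopy relative to the boundary of the cube. *)
Definition homotopic (R : realType) (n : nat) (X : topologicalType) (x : X)
    (f g : nloop R n x) : Prop :=
  exists H : unit_itv R * cube R n -> X,
    [/\ continuous H,
        forall t u, \val t = 0 -> H (t, u) = f u,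
        forall t u, \val t = 1 -> H (t, u) = g u &
        forall t u, cube_boundary u -> H (t, u) = x].

Lemma unit_itvP (R : realType) (t : R) : unit_itv R t <-> 0 <= t <= 1.
Proof. by rewrite /unit_itv /= in_itv. Qed.

Lemma continuous_set_val (X : topologicalType) (A : set X) :
  continuous (fun a : A => \val a).
Proof. exact: (@initial_continuous A X set_val). Qed.

Lemma continuous_to_set (X Y : topologicalType) (A : set X) (f : Y -> A) :
  continuous (fun y => \val (f y)) -> continuous f.
Proof. exact: (@continuous_comp_initial A Y X set_val f). Qed.

Lemma reparam_subproof (R : realType) (h : R -> R) :
  unit_itv R (Num.max 0 (Num.min 1 (h 0))).
Proof.
by apply/unit_itvP; rewrite le_max lexx ge_max ler01 ge_min lexx.
Qed.

Definition reparam (R : realType) (h : R -> R) (t : unit_itv R) : unit_itv R :=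
  exist _ (Num.max 0 (Num.min 1 (h (\val t))))
    (mem_set (@reparam_subproof R (fun=> h (\val t)))).

Lemma reparam_continuous (R : realType) (h : R -> R) :
  continuous h -> continuous (reparam h).
Proof.
move=> ch; apply: continuous_to_set => t /=.
pose k (s : unit_itv R) : R^o := h (\val s).
have ck : {for t, continuous k}.
  apply: (@continuous_comp _ _ _ (fun s : unit_itv R => \val s) h).
    exact: continuous_set_val.
  exact: ch.
have c1 : {for t, continuous (cst 1 \min k)}.
  have c2 : {for t, continuous (cst 1 : unit_itv R -> R^o)}.
    exact: cst_continuous.
  exact: (continuous_min c2 ck).
have c0 : {for t, continuous (cst 0 : unit_itv R -> R^o)}.
  exact: cst_continuous.
exact: (continuous_max c0 c1).
Qed.

Lemma reparam_val (R : realType) (h : R -> R) (t : unit_itv R) :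
  0 <= h (\val t) <= 1 -> \val (reparam h t) = h (\val t).
Proof. by move=> /andP[h0 h1] /=; rewrite (min_idPr h1) (max_idPr h0). Qed.

Lemma continuous_homotopy_reparam (R : realType) (n : nat)
    (X : topologicalType) (H : unit_itv R * cube R n -> X) (h : R -> R) :
  continuous H -> continuous h ->
  continuous (fun p : unit_itv R * cube R n => H (reparam h p.1, p.2)).
Proof.
move=> cH ch p.
apply: (@continuous_comp _ _ _ (fun p : unit_itv R * cube R n =>
  (reparam h p.1, p.2)) H); last exact: cH.
have c1 : (reparam h q.1) @[q --> p] --> reparam h p.1.
  apply: (@continuous_comp _ _ _ fst (reparam h)); first exact: cvg_fst.
  exact: reparam_continuous.
have c2 : q.2 @[q --> p] --> p.2 by exact: cvg_snd.
exact: (cvg_pair c1 c2).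
Qed.

Lemma homotopic_refl (R : realType) (n : nat) (X : topologicalType) (x : X)
  (f : nloop R n x) : homotopic f f.
Proof.
exists (f \o snd); split=> //=; last by move=> t u; exact: nloop_boundary.
move=> p; apply: (@continuous_comp _ _ _ snd f); first exact: cvg_snd.
exact: nloop_continuous.
Qed.

Lemma homotopic_sym (R : realType) (n : nat) (X : topologicalType) (x : X)
  (f g : nloop R n x) : homotopic f g -> homotopic g f.
Proof.
move=> [H [cH H0 H1 Hb]]; pose h (t : R) := 1 - t.
exists (fun p => H (reparam h p.1, p.2)); split=> [|t u t0|t u t1|t u bu].
- apply: continuous_homotopy_reparam => // t.
  by apply: cvgB; [exact: cvg_cst|exact: cvg_id].
- by apply: H1; rewrite reparam_val /h t0 subr0 ?ler01 ?lexx.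
- by apply: H0; rewrite reparam_val /h t1 subrr ?ler01 ?lexx.
- exact: Hb.
Qed.

Lemma homotopic_trans (R : realType) (n : nat) (X : topologicalType) (x : X)
  (f g k : nloop R n x) : homotopic f g -> homotopic g k -> homotopic f k.
Proof.
move=> [H [cH H0 H1 Hb]] [K [cK K0 K1 Kb]].
pose a (t : R) := 2 * t; pose b (t : R) := 2 * t - 1.
have ca : continuous a by move=> t; apply: cvgM; [exact: cvg_cst|exact: cvg_id].
have cb : continuous b by move=> t; apply: cvgB; [exact: ca|exact: cvg_cst].
pose F (p : unit_itv R * cube R n) := H (reparam a p.1, p.2).
pose G (p : unit_itv R * cube R n) := K (reparam b p.1, p.2).
have cF : continuous F by exact: continuous_homotopy_reparam.
have cG : continuous G by exact: continuous_homotopy_reparam.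
have cfst : continuous (fun p : unit_itv R * cube R n => \val p.1).
  move=> p; apply: (@continuous_comp _ _ _ fst (fun t : unit_itv R => \val t)).
    exact: cvg_fst.
  exact: continuous_set_val.
pose A := [set p : unit_itv R * cube R n | \val p.1 <= 2^-1].
pose B := [set p : unit_itv R * cube R n | 2^-1 <= \val p.1].
have /continuous_closedP clfst := cfst.
have cA : closed A := clfst _ (@closed_le _ 2^-1).
have cB : closed B := clfst _ (@closed_ge _ 2^-1).
pose L p := if \val p.1 <= 2^-1 then F p else G p.
have LF : {in A, F =1 L} by move=> p /set_mem Ap; rewrite /L ifT.
have LG : {in B, G =1 L}.
  move=> [t u] /set_mem /= Bt; rewrite /L; case: ifPn => //= At.
  have t2 : \val t = 2^-1 by apply/le_anti; rewrite At Bt.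
  have at1 : a (\val t) = 1 by rewrite /a t2 mulfV ?pnatr_eq0.
  have bt0 : b (\val t) = 0 by rewrite /b t2 mulfV ?subrr ?pnatr_eq0.
  have rat : \val (reparam a t) = 1 by rewrite reparam_val at1 ?lexx ?ler01.
  have rbt : \val (reparam b t) = 0 by rewrite reparam_val bt0 ?lexx ?ler01.
  by rewrite /F /G /= H1 ?K0.
exists L; split=> [|t u t0|t u t1|t u bu].
- suff : {within A `|` B, continuous L}.
    have -> : A `|` B = setT.
      by apply/seteqP; split=> // p _; have /orP := le_total (\val p.1) 2^-1.
    by move=> cL; apply/continuous_subspace_setT.
  apply: withinU_continuous => //.
    exact/(subspace_eq_continuous LF)/continuous_subspaceT.
  exact/(subspace_eq_continuous LG)/continuous_subspaceT.
- have at0 : a (\val t) = 0 by rewrite /a t0 mulr0.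
  have rat : \val (reparam a t) = 0 by rewrite reparam_val at0 ?lexx ?ler01.
  by rewrite /L /= t0 invr_ge0 ler0n /F /= H0.
- have bt1 : b (\val t) = 1 by rewrite /b t1 mulr1 -[2]/(1 + 1) addrK.
  have rbt : \val (reparam b t) = 1 by rewrite reparam_val bt1 ?lexx ?ler01.
  have lt21 : (2^-1 : R) < 1 by rewrite invf_lt1 ?ltr1n ?ltr0n.
  by rewrite /L /= t1 leNgt lt21 /G /= K1.
- by rewrite /L /F /G /=; case: ifP => _; [exact: Hb|exact: Kb].
Qed.

Definition homotopicb (R : realType) (n : nat) (X : topologicalType) (x : X)
  (f g : nloop R n x) : bool := `[< homotopic f g >].

Lemma homotopicb_refl (R : realType) (n : nat) (X : topologicalType) (x : X) :
  reflexive (@homotopicb R n X x).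
Proof. by move=> f; apply/asboolP/homotopic_refl. Qed.

Lemma homotopicb_sym (R : realType) (n : nat) (X : topologicalType) (x : X) :
  symmetric (@homotopicb R n X x).
Proof. by move=> f g; apply/asboolP/asboolP; exact: homotopic_sym. Qed.

Lemma homotopicb_trans (R : realType) (n : nat) (X : topologicalType) (x : X) :
  transitive (@homotopicb R n X x).
Proof.
by move=> f g k /asboolP gf /asboolP fk; apply/asboolP/(homotopic_trans gf fk).
Qed.

Canonical homotopic_equiv (R : realType) (n : nat) (X : topologicalType)
    (x : X) :=
  EquivRel (@homotopicb R n X x) (@homotopicb_refl R n X x)
    (@homotopicb_sym R n X x) (@homotopicb_trans R n X x).

(* The pointed set underlying pi_n(X, x); countability and triviality do not
   involve the group law. *)
Definition homotopy_group (R : realType) (n : nat) (X : topologicalType)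
    (x : X) :=
  {eq_quot (homotopic_equiv R n x)}.
HB.instance Definition _ (R : realType) (n : nat) (X : topologicalType)
  (x : X) := EqQuotient.on (homotopy_group R n x).

Definition cst_nloop (R : realType) (n : nat) (X : topologicalType) (x : X) :
    nloop R n x :=
  @NLoop R n X x (cst x) (@cst_continuous _ _ x) (fun _ _ => erefl).

Definition homotopy_one (R : realType) (n : nat) (X : topologicalType) (x : X) :
    homotopy_group R n x :=
  \pi_(homotopy_group R n x) (cst_nloop R n x).

Lemma comp_nloop_continuous (R : realType) (n : nat) (X Y : topologicalType)
  (h : X -> Y) (ch : continuous h) (x : X) (f : nloop R n x) :
  continuous (h \o f).
Proof.
move=> u; apply: (@continuous_comp _ _ _ f h); first exact: nloop_continuous.
exact: ch.
Qed.

Lemma comp_nloop_boundary (R : realType) (n : nat) (X Y : topologicalType)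
  (h : X -> Y) (x : X) (f : nloop R n x) (u : cube R n) :
  cube_boundary u -> (h \o f) u = h x.
Proof. by move=> bu /=; rewrite nloop_boundary. Qed.

Definition comp_nloop (R : realType) (n : nat) (X Y : topologicalType)
    (h : X -> Y) (ch : continuous h) (x : X) (f : nloop R n x) :
    nloop R n (h x) :=
  @NLoop R n Y (h x) (h \o f) (@comp_nloop_continuous R n X Y h ch x f)
    (@comp_nloop_boundary R n X Y h x f).

Definition homotopy_map (R : realType) (n : nat) (X Y : topologicalType)
    (h : X -> Y) (ch : continuous h) (x : X) (c : homotopy_group R n x) :
    homotopy_group R n (h x) :=
  \pi_(homotopy_group R n (h x)) (comp_nloop ch (repr c)).

Lemma comp_nloop_homotopic (R : realType) (n : nat) (X Y : topologicalType)
  (h : X -> Y) (ch : continuous h) (x : X) (f g : nloop R n x) :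
  homotopic f g -> homotopic (comp_nloop ch f) (comp_nloop ch g).
Proof.
move=> [H [cH H0 H1 Hb]]; exists (h \o H); split=> [p|t u t0|t u t1|t u bu] /=.
- by apply: (@continuous_comp _ _ _ H h); [exact: cH|exact: ch].
- by rewrite H0.
- by rewrite H1.
- by rewrite Hb.
Qed.

Lemma homotopy_group_eqP (R : realType) (n : nat) (X : topologicalType)
  (x : X) (f g : nloop R n x) :
  \pi_(homotopy_group R n x) f = \pi_(homotopy_group R n x) g <-> homotopic f g.
Proof.
by split=> [/eqmodP/asboolP//|fg]; apply/eqmodP/asboolP.
Qed.

(* [homotopy_map] does not depend on the chosen representative. *)
Lemma homotopy_map_pi (R : realType) (n : nat) (X Y : topologicalType)
  (h : X -> Y) (ch : continuous h) (x : X) (f : nloop R n x) :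
  homotopy_map ch (\pi_(homotopy_group R n x) f) =
  \pi_(homotopy_group R n (h x)) (comp_nloop ch f).
Proof.
apply/homotopy_group_eqP/comp_nloop_homotopic/homotopy_group_eqP.
by rewrite reprK.
Qed.

Definition trivial_homotopy_group (R : realType) (n : nat)
    (X : topologicalType) (x : X) : Prop :=
  forall c : homotopy_group R n x, c = homotopy_one R n x.

Definition trivial_homotopy_map (R : realType) (n : nat)
    (X Y : topologicalType) (h : X -> Y) (ch : continuous h) (x : X) : Prop :=
  forall c : homotopy_group R n x, homotopy_map ch c = homotopy_one R n (h x).

Lemma set_incl_subproof (X : Type) (V U : set X) (VU : V `<=` U) (v : V) :
  \val v \in U.
Proof. exact/mem_set/VU/set_mem/valP. Qed.

Definition set_incl (X : Type) (V U : set X) (VU : V `<=` U) (v : V) : U :=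
  exist _ (\val v) (set_incl_subproof VU v).

Lemma set_incl_continuous (X : topologicalType) (V U : set X)
  (VU : V `<=` U) : continuous (set_incl VU).
Proof. by apply: continuous_to_set; exact: continuous_set_val. Qed.

Definition path_connected_space (R : realType) (X : topologicalType) : Prop :=
  [set: X] !=set0 /\
  forall x y : X, exists p : unit_itv R -> X,
    [/\ continuous p, forall t, \val t = 0 -> p t = x &
        forall t, \val t = 1 -> p t = y].

Definition m_connected (R : realType) (m : nat) (X : topologicalType) : Prop :=
  path_connected_space R X /\
  forall (k : nat) (x : X), (1 <= k <= m)%N -> trivial_homotopy_group R k x.

(* Neighborhoods are not required to be open. *)
Definition locally_m_connected (R : realType) (m : nat)
    (X : topologicalType) : Prop :=
  forall (x : X) (U : set X), nbhs x U ->
    exists (V : set X) (VU : V `<=` U), nbhs x V /\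
      forall (k : nat) (v : V), (k <= m)%N ->
        trivial_homotopy_map R k (@set_incl_continuous X V U VU) v.

Definition semilocally_n_connected_at (R : realType) (n : nat)
    (X : topologicalType) (x : X) : Prop :=
  exists (U : set X) (Ux : x \in U), open U /\
    trivial_homotopy_map R n (@continuous_set_val X U) (exist _ x Ux : U).

Definition semilocally_n_connected (R : realType) (n : nat)
    (X : topologicalType) : Prop :=
  forall x : X, semilocally_n_connected_at R n x.

Definition separable (X : topologicalType) : Prop :=
  exists2 D : set X, countable D & dense D.

(* Main.v *)
Require Import Defs.
From mathcomp Require Import all_boot all_order all_algebra.
From mathcomp Require Import all_classical all_reals all_analysis.
From mathcomp Require Import ring lra.

Set Implicit Arguments.
Unset Strict Implicit.
Unset Printing Implicit Defensive.
Import Order.TTheory GRing.Theory Num.Theory.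
Import numFieldNormedType.Exports.
Local Open Scope classical_set_scope.
Local Open Scope ring_scope.

(** Two [n]-loops that are uniformly close are homotopic, and up to small
    perturbation there are only countably many [n]-loops; hence [pi_n] is
    countable.

    Closeness implies homotopy. Given a loop [f], consider the constant homotopy
    [F (t, u) = f u] on the cube of dimension [n + 1]. For a loop [g] close to
    [f], the map [phi] equal to [f] on the face [t = 0], to [g] on the face
    [t = 1] and to the base point on the other faces is close to [F] on the
    boundary, and a homotopy from [f] to [g] is an extension of [phi] to the
    whole cube. So it suffices that maps on the boundary which are close enough
    to [F] extend ([extends_near_top]). Call this the extension property of [F].

    If the cube is cut in two halves by a wall, the extension property of [F]
    follows from that of its restrictions to the two halves, provided that on
    the wall, a cube of one dimension less, boundary values close to [F] have
    extensions that are themselves close to [F] ([extends_near_split]). By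
    compactness of the cube and repeated bisection it is therefore enough to
    know the property for cubes which [F] maps into a small ball
    ([extends_near_local]), and the same reduction works for the version with
    control, by induction on the dimension. On small cubes, local
    [(n - 1)]-connectedness gives extensions with control in dimensions at most
    [n] ([extends_near_small]), and semilocal [n]-connectedness gives extensions
    without control in dimension [n + 1] ([extends_near_small_top]).

    To pass from homotopy groups to extensions, the cube of dimension [k + 1] is
    written, for [k > 0], as an explicit quotient [cone] of the cylinder over
    the cube of dimension [k]: the base is wrapped around the boundary, with the
    boundary of the base going to a single point, and the top is collapsed to
    the centre. A map on the boundary of the big cube becomes a [k]-loop, and a
    null homotopy of that loop descends to an extension ([extend_sphere]).

    Countability. A loop is uniformly continuous, so that up to any given error
    it is described by a mesh and, for each cell of the grid, an index in a
    dense sequence ([near_code_exists]). These codes form a countable type, and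
    loops with the same sufficiently precise code are homotopic. *)

(** * Continuity on subsets and gluing *)

Section continuity.
Variables T S X : topologicalType.

Lemma within_continuous_precomp (A : set S) (B : set T) (h : S -> T)
    (g : T -> X) :
  continuous h -> (forall s, A s -> B (h s)) ->
  {within B, continuous g} -> {within A, continuous (g \o h)}.
Proof.
move=> ch AB /subspace_continuousP cg; apply/subspace_continuousP => s As W gW.
have := cg _ (AB _ As) W gW; rewrite /within /= => gW'.
by have := ch s _ gW'; rewrite nbhs_simpl /=; apply: filterS => u /= + Au;
  apply; exact: AB.
Qed.

Lemma within_continuous_eq (A : set T) (f g : T -> X) :
  (forall t, A t -> f t = g t) ->
  {within A, continuous f} -> {within A, continuous g}.
Proof. by move=> fg; apply: subspace_eq_continuous => t /set_mem /fg. Qed.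

Lemma within_continuous_sub (A B : set T) (f : T -> X) :
  A `<=` B -> {within B, continuous f} -> {within A, continuous f}.
Proof. by move=> AB; apply: continuous_subspaceW. Qed.

(** A continuous map on a compact set that is constant on the fibres of [q]
    descends to the image of [q], because [q] is a closed map. *)
Lemma within_continuous_quotient (K : set S) (q : S -> T) (g : S -> X)
    (f : T -> X) :
  hausdorff_space T -> compact K -> continuous q -> continuous g ->
  (forall s, K s -> f (q s) = g s) -> {within q @` K, continuous f}.
Proof.
move=> hT cK cq cg fg; apply/subspace_continuousP => p [s0 Ks0 qs0] W fW.
have [V [oV Vfp] VW] : exists2 V, open_nbhs (f p) V & V `<=` W.
  by move: fW; rewrite nbhsE.
pose C := K `&` ~` (g @^-1` V).
have cC : compact C.
  apply: compact_closedI => //; apply: open_closedC.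
  by apply: open_comp => // s _; exact: cg.
have clC : closed (q @` C).
  by apply: compact_closed => //; apply: continuous_compact => //;
    exact: continuous_subspaceT.
have : nbhs p (~` (q @` C)).
  apply: open_nbhs_nbhs; split; first exact: closed_openC.
  by move=> [s [Ks nVs] qs]; apply: nVs; rewrite /= -fg // qs.
rewrite /within /= nbhs_simpl /=; apply: filterS => p' nC [s Ks qs].
apply: VW; apply: contrapT => nV; apply: nC; exists s => //; split=> //=.
by rewrite -fg // qs.
Qed.

End continuity.

(** Gluing of two maps along the complementary conditions [s <= c] and
    [s >= c] on a continuous real parameter [s]. *)
Lemma within_continuous_le_glue (R : realType) (T X : topologicalType)
    (A : set T) (s : T -> R) (c : R) (f g : T -> X) :
  closed A -> continuous s ->
  {within A `&` [set t | s t <= c], continuous f} ->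
  {within A `&` [set t | c <= s t], continuous g} ->
  (forall t, A t -> s t = c -> f t = g t) ->
  {within A, continuous (fun t => if s t <= c then f t else g t)}.
Proof.
move=> cA cs cf cg fg.
have /continuous_closedP cls := cs.
have cle : closed [set t | s t <= c] := cls _ (@closed_le _ c).
have cge : closed [set t | c <= s t] := cls _ (@closed_ge _ c).
have -> : A = (A `&` [set t | s t <= c]) `|` (A `&` [set t | c <= s t]).
  apply/seteqP; split=> [t At|t [[]|[]]//].
  by have /orP[] := le_total (s t) c => ?; [left|right].
apply: withinU_continuous; [exact: closedI|exact: closedI| |].
  by apply: within_continuous_eq cf => t [At /= ->].
apply: within_continuous_eq cg => t [At /= ct]; case: ifPn => // tc.
by rewrite fg //; apply/le_anti; rewrite tc ct.
Qed.

Lemma continuous_pair (T U V : topologicalType) (f : T -> U) (g : T -> V) :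
  continuous f -> continuous g -> continuous (fun t => (f t, g t)).
Proof. by move=> cf cg t; exact: (cvg_pair (cf t) (cg t)). Qed.

Lemma continuous_composed (T U V : topologicalType) (f : T -> U) (g : U -> V) :
  continuous f -> continuous g -> continuous (fun t => g (f t)).
Proof. by move=> cf cg t; exact: (continuous_comp (cf t) (cg (f t))). Qed.

Section real_valued.
Variables (R : realType) (T : topologicalType).
Implicit Types f g : T -> R.

Lemma fun_continuousD f g :
  continuous f -> continuous g -> continuous (fun t => f t + g t).
Proof. by move=> cf cg t; apply: cvgD; [exact: cf|exact: cg]. Qed.

Lemma fun_continuousB f g :
  continuous f -> continuous g -> continuous (fun t => f t - g t).
Proof. by move=> cf cg t; apply: cvgB; [exact: cf|exact: cg]. Qed.

Lemma fun_continuousM f g :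
  continuous f -> continuous g -> continuous (fun t => f t * g t).
Proof. by move=> cf cg t; apply: cvgM; [exact: cf|exact: cg]. Qed.

Lemma fun_continuousV f :
  (forall t, f t != 0) -> continuous f -> continuous (fun t => (f t)^-1).
Proof. by move=> f0 cf t; apply: cvgV; [exact: f0|exact: cf]. Qed.

Lemma fun_continuous_max f g :
  continuous f -> continuous g -> continuous (fun t => Num.max (f t) (g t)).
Proof.
by move=> cf cg t; apply: (@continuous_max R T f g); [exact: cf|exact: cg].
Qed.

Lemma fun_continuous_min f g :
  continuous f -> continuous g -> continuous (fun t => Num.min (f t) (g t)).
Proof.
by move=> cf cg t; apply: (@continuous_min R T f g); [exact: cf|exact: cg].
Qed.

Lemma fun_continuous_cst (c : R) : continuous (fun _ : T => c).
Proof. by move=> t; exact: cvg_cst. Qed.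

End real_valued.

(** * Cubes and their faces *)

Section cubes.
Variable R : realType.
Implicit Types n : nat.

Lemma row_continuous (T : topologicalType) n (f : T -> 'rV[R]_n) :
  (forall j, continuous (fun t => f t ord0 j)) -> continuous f.
Proof.
move=> cf t W [P tP PW]; rewrite nbhs_simpl /=.
have : \forall s \near t, forall j, P ord0 j (f s ord0 j).
  by apply: filter_forall => j; apply: cf; exact: tP.
by apply: filterS => s Ps; apply: PW => i j; rewrite ord1; exact: Ps.
Qed.

(** [cube_boundary] as a subset of the ambient vector space: maps given on a
    part of it are then total functions that are continuous within that part. *)
Definition bdry n : set 'rV[R]_n :=
  [set u | cube R n u /\ exists i, u ord0 i = 0 \/ u ord0 i = 1].

Definition ins n (i : 'I_n.+1) (c : R) (q : 'rV[R]_n) : 'rV[R]_n.+1 :=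
  \row_j oapp (q ord0) c (unlift i j).

Definition del n (i : 'I_n.+1) (p : 'rV[R]_n.+1) : 'rV[R]_n := col' i p.

Lemma ins_at n (i : 'I_n.+1) c q : ins i c q ord0 i = c.
Proof. by rewrite mxE unlift_none. Qed.

Lemma ins_lift n (i : 'I_n.+1) c q k : ins i c q ord0 (lift i k) = q ord0 k.
Proof. by rewrite mxE liftK. Qed.

Lemma insK n (i : 'I_n.+1) c : cancel (ins i c) (del i).
Proof. by move=> q; apply/rowP => k; rewrite mxE ins_lift. Qed.

Lemma ins_del n (i : 'I_n.+1) (p : 'rV[R]_n.+1) :
  ins i (p ord0 i) (del i p) = p.
Proof.
by apply/rowP => j; rewrite mxE; case: unliftP => [k ->|->] //=; rewrite mxE.
Qed.

Lemma cube_ins n (i : 'I_n.+1) c q :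
  cube R n.+1 (ins i c q) <-> 0 <= c <= 1 /\ cube R n q.
Proof.
split=> [qi|[c01 cq] j].
  by split=> [|k]; [have := qi i; rewrite ins_at|
    have := qi (lift i k); rewrite ins_lift].
by rewrite mxE; case: unliftP => [k _|_] //=; exact: cq.
Qed.

Lemma bdry_ins n (i : 'I_n.+1) c q :
  bdry (ins i c q) <->
  [/\ 0 <= c <= 1, cube R n q & c = 0 \/ c = 1 \/ bdry q].
Proof.
split=> [[/cube_ins[c01 cq] [j]]|[c01 cq h]].
  rewrite mxE; case: unliftP => [k _ /= qk|_ /= c1]; split=> //.
    by right; right; split=> //; exists k.
  by case: c1; [left|right; left].
split; first exact/cube_ins.
case: h => [c0|[c1|[_ [k qk]]]]; [exists i|exists i|exists (lift i k)].
- by rewrite ins_at; left.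
- by rewrite ins_at; right.
- by rewrite ins_lift.
Qed.

Lemma coord_row_continuous n (j : 'I_n) :
  continuous (fun p : 'rV[R]_n => p ord0 j).
Proof. exact: coord_continuous. Qed.

Lemma del_continuous n (i : 'I_n.+1) : continuous (del i).
Proof.
apply: row_continuous => j p; under eq_fun do rewrite mxE.
exact: coord_continuous.
Qed.

Lemma ins_continuous (T : topologicalType) n (i : 'I_n.+1)
    (c : T -> R) (q : T -> 'rV[R]_n) :
  continuous c -> continuous q -> continuous (fun t => ins i (c t) (q t)).
Proof.
move=> cc cq; apply: row_continuous => j t; under eq_fun do rewrite mxE.
case: unliftP => [k _|_] /=; last exact: cc.
apply: (@continuous_comp _ _ _ q (fun p : 'rV[R]_n => p ord0 k)).
  exact: cq.
exact: coord_continuous.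
Qed.

Lemma cube_compact n : compact (cube R n).
Proof.
have -> : cube R n =
    [set u : 'rV[R]_n | forall i, (`[0, 1]%classic : set R) (u ord0 i)].
  apply/seteqP; split=> u cu i; have := cu i; rewrite /= in_itv //=.
exact: (@rV_compact _ n (fun=> `[0, 1]%classic : set R)
  (fun=> @segment_compact R 0 1)).
Qed.

Lemma cube_closed n : closed (cube R n).
Proof. exact: (compact_closed (@norm_hausdorff R _) (@cube_compact n)). Qed.

(** The form in which compactness of the cube is used, as with a Lebesgue
    number. *)
Lemma cube_uniform_radius n (P : R -> 'rV[R]_n -> Prop) :
  (forall p, cube R n p -> exists2 rho, 0 < rho & forall q r,
     ball p rho q -> 0 < r < rho -> P r q) ->
  exists2 r, 0 < r & forall q, cube R n q -> P r q.
Proof.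
move=> loc; have /compact_near_coveringP cov0 := @cube_compact n.
have cov := cov0 R (0 : R)^'+ P (at_right_proper_filter 0).
suff /cov covr : forall p, cube R n p ->
    \forall q \near p & r \near 0^'+, P r q.
  have [r [covr_r r_gt0]] := @filter_ex _ _ (at_right_proper_filter (0 : R)) _
    (filterI covr (nbhs_right_gt (0 : R))).
  by exists r.
move=> p /loc[rho rho_gt0 rhoP].
exists (ball p rho, [set r | 0 < r < rho]) => /=; last first.
  by move=> [q r] /= [pq r_lt]; exact: rhoP.
split; first exact: nbhsx_ballx.
near=> r => /=; apply/andP; split; first by near: r; exact: nbhs_right_gt.
by near: r; exact: nbhs_right_lt.
Unshelve. all: end_near. Qed.

Definition clamp (t : R) : R := Num.max 0 (Num.min 1 t).

Lemma clamp01 t : 0 <= clamp t <= 1.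
Proof. by rewrite le_max lexx ge_max ler01 ge_min lexx. Qed.

Lemma clampK t : 0 <= t <= 1 -> clamp t = t.
Proof. by move=> /andP[t0 t1]; rewrite /clamp (min_idPr t1) (max_idPr t0). Qed.

Lemma clamp_continuous (T : topologicalType) (f : T -> R) :
  continuous f -> continuous (fun t => clamp (f t)).
Proof.
move=> cf; apply: fun_continuous_max; first exact: fun_continuous_cst.
by apply: fun_continuous_min => //; exact: fun_continuous_cst.
Qed.

Lemma itv_retr_subproof (t : R) : clamp t \in unit_itv R.
Proof. exact/mem_set/unit_itvP/clamp01. Qed.

Definition itv_retr (t : R) : unit_itv R :=
  exist _ (clamp t) (itv_retr_subproof t).

Lemma cube_retr_subproof n (u : 'rV[R]_n) :
  (\row_j clamp (u ord0 j)) \in cube R n.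
Proof. by apply/mem_set => j; rewrite mxE clamp01. Qed.

Definition cube_retr n (u : 'rV[R]_n) : cube R n :=
  exist _ (\row_j clamp (u ord0 j)) (cube_retr_subproof u).

Lemma itv_retr_val t : 0 <= t <= 1 -> \val (itv_retr t) = t.
Proof. exact: clampK. Qed.

Lemma cube_retr_val n (u : 'rV[R]_n) : cube R n u -> \val (cube_retr u) = u.
Proof. by move=> cu; apply/rowP => j /=; rewrite mxE clampK. Qed.

Lemma val_cube n (u : cube R n) : cube R n (\val u).
Proof. by move/set_mem: (valP u). Qed.

Lemma val_cubeK n : cancel (fun u : cube R n => \val u) (@cube_retr n).
Proof. by move=> u; apply/val_inj/cube_retr_val/val_cube. Qed.

Lemma val_itv (t : unit_itv R) : 0 <= \val t <= 1.
Proof. by apply/unit_itvP; move/set_mem: (valP t). Qed.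

Lemma itv_retr_continuous : continuous itv_retr.
Proof.
by apply: continuous_to_set; apply: clamp_continuous => t; exact: cvg_id.
Qed.

Lemma cube_retr_continuous n : continuous (@cube_retr n).
Proof.
apply: continuous_to_set; apply: row_continuous => j /=.
under eq_fun do rewrite mxE.
exact/clamp_continuous/coord_row_continuous.
Qed.

Lemma cube_boundary_retr n (u : 'rV[R]_n) :
  bdry u -> cube_boundary (cube_retr u).
Proof.
move=> [cu bu].
exact: (eq_ind_r (fun v : 'rV[R]_n => exists i, v ord0 i = 0 \/ v ord0 i = 1)
  bu (cube_retr_val cu)).
Qed.

Lemma cube_boundary_bdry n (u : cube R n) : cube_boundary u <-> bdry (\val u).
Proof. by split=> [bu|[]//]; split=> //; exact: val_cube. Qed.

Lemma bdry_closed n : closed (@bdry n).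
Proof.
have -> : @bdry n = cube R n `&`
    \bigcup_(i in [set: 'I_n])
      ([set u | u ord0 i = 0] `|` [set u | u ord0 i = 1]).
  by apply/seteqP; split=> u [cu [i]]; [move=> h; split=> //; exists i|
    move=> _ h; split=> //; exists i].
apply: closedI; first exact: cube_closed.
apply: closed_bigcup => [|i _]; first exact: finite_finset.
by apply: closedU;
  apply: (@closed_comp _ _ (fun u : 'rV[R]_n => u ord0 i) [set _]);
  move=> *; try exact: coord_continuous; exact: closed_eq.
Qed.

End cubes.

(** * Extending maps from the boundary of a cube *)

Section extension.
Variables (R : realType) (X : pseudoMetricType R).
Implicit Types d : nat.

(** The extension property that the proof propagates from small cubes to large
    ones. The relation [E] is closeness up to some [e] in low dimensions, where
    the extension has to serve as a boundary value for the next dimension, and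
    the full relation in the top dimension. *)
Definition extends_near d (E : X -> X -> Prop) (F : 'rV[R]_d -> X) : Prop :=
  exists2 delta : R, 0 < delta & forall phi : 'rV[R]_d -> X,
    {within @bdry R d, continuous phi} ->
    (forall p, bdry p -> ball (F p) delta (phi p)) ->
    exists Phi : 'rV[R]_d -> X,
      [/\ {within cube R d, continuous Phi},
          forall p, bdry p -> Phi p = phi p &
          forall p, cube R d p -> E (F p) (Phi p)].

(** The cube is cut by the wall [p_i = 1/2]; the values [b = 0] and [b = 1]
    select the half into which [to_half] squeezes it. *)
Definition to_half d (i : 'I_d.+1) (b : R) (p : 'rV[R]_d.+1) : 'rV[R]_d.+1 :=
  ins i ((b + p ord0 i) / 2) (del i p).

Definition from_half d (i : 'I_d.+1) (b : R) (p : 'rV[R]_d.+1) : 'rV[R]_d.+1 :=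
  ins i (2 * p ord0 i - b) (del i p).

Lemma to_half_continuous d (i : 'I_d.+1) b : continuous (to_half i b).
Proof.
apply: ins_continuous; last exact: del_continuous.
apply: fun_continuousM; last exact: fun_continuous_cst.
by apply: fun_continuousD;
  [exact: fun_continuous_cst|exact: coord_row_continuous].
Qed.

Lemma from_half_continuous d (i : 'I_d.+1) b : continuous (from_half i b).
Proof.
apply: ins_continuous; last exact: del_continuous.
apply: fun_continuousB; last exact: fun_continuous_cst.
by apply: fun_continuousM;
  [exact: fun_continuous_cst|exact: coord_row_continuous].
Qed.

Lemma from_halfK d (i : 'I_d.+1) b p : to_half i b (from_half i b p) = p.
Proof.
rewrite /to_half /from_half ins_at insK -[RHS](ins_del i p); congr ins.
by field.
Qed.

Lemma cube_del d (i : 'I_d.+1) p :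
  cube R d.+1 p <-> 0 <= p ord0 i <= 1 /\ cube R d (del i p).
Proof. by rewrite -{1}(ins_del i p); exact: cube_ins. Qed.

Lemma bdry_del d (i : 'I_d.+1) p :
  bdry p <-> [/\ 0 <= p ord0 i <= 1, cube R d (del i p) &
                 p ord0 i = 0 \/ p ord0 i = 1 \/ bdry (del i p)].
Proof. by rewrite -{1}(ins_del i p); exact: bdry_ins. Qed.

(** The boundary of the cube without the interior of its face [p_i = c]. *)
Definition open_box d (i : 'I_d.+1) (c : R) : set 'rV[R]_d.+1 :=
  [set p | cube R d.+1 p /\ (p ord0 i = 1 - c \/ bdry (del i p))].

Definition replace_face d (i : 'I_d.+1) (c : R) (w : 'rV[R]_d -> X)
    (phi : 'rV[R]_d.+1 -> X) (p : 'rV[R]_d.+1) : X :=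
  if p ord0 i == c then w (del i p) else phi p.

Lemma replace_face_continuous d (i : 'I_d.+1) (c : R) w phi :
  c = 0 \/ c = 1 ->
  {within cube R d, continuous w} ->
  {within open_box i c, continuous phi} ->
  (forall p, cube R d.+1 p -> p ord0 i = c -> bdry (del i p) ->
     w (del i p) = phi p) ->
  {within @bdry R d.+1, continuous (replace_face i c w phi)}.
Proof.
move=> c01 cw cphi wphi.
pose A := [set p : 'rV[R]_d.+1 | cube R d.+1 p /\ p ord0 i = c].
have clA : closed A.
  apply: closedI; first exact: cube_closed.
  have /continuous_closedP cl := @coord_row_continuous R _ i.
  exact: (cl _ (@closed_eq _ c)).
have clB : closed (open_box i c).
  apply: closedI; first exact: cube_closed.
  have /continuous_closedP cl := @coord_row_continuous R _ i.
  have /continuous_closedP cl' := @del_continuous R _ i.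
  by apply: closedU; [exact: (cl _ (@closed_eq _ (1 - c)))|
    exact: (cl' _ (@bdry_closed R d))].
apply: (@within_continuous_sub _ _ _ (A `|` open_box i c)).
  move=> p bp; have [p01 cp h] := (bdry_del i p).1 bp.
  have cup : cube R d.+1 p by apply/(cube_del i).
  rewrite /A; case: c01 h => -> [p0|[p1|bd]].
  - by left.
  - by right; split=> //; left; rewrite subr0.
  - by right; split=> //; right.
  - by right; split=> //; left; rewrite subrr.
  - by left.
  - by right; split=> //; right.
apply: withinU_continuous => //.
  apply: (@within_continuous_eq _ _ _ (w \o del i)).
    by move=> p [_ pc]; rewrite /replace_face pc eqxx.
  apply: within_continuous_precomp cw; first exact: del_continuous.
  by move=> p [/(cube_del i)[]].
apply: within_continuous_eq cphi => p [cup h]; rewrite /replace_face.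
case: eqP => // pc; rewrite wphi //; case: h => // p1.
by exfalso; case: c01 => c0; lra.
Qed.

Lemma half_cube d (i : 'I_d.+1) b p : b = 0 \/ b = 1 ->
  cube R d.+1 p -> cube R d.+1 (to_half i b p).
Proof.
move=> b01 /(cube_del i)[/andP[p0 p1] cp]; apply/cube_ins; split=> //.
by case: b01 => ->; lra.
Qed.

Lemma half_open_box d (i : 'I_d.+1) b p : b = 0 \/ b = 1 ->
  open_box i (1 - b) p -> bdry (to_half i b p).
Proof.
move=> b01 [cup h]; apply/bdry_ins.
have /cube_ins[? ?] := half_cube i b01 cup; split=> //.
case: h => [->|]; last by right; right.
by case: b01 => ->; [left|right; left]; lra.
Qed.

(** Once the wall between the two halves has been filled, by [w], the whole
    boundary of either half carries a map close to [F], to which the extension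
    property of that half applies. *)
Lemma extend_half d (i : 'I_d.+1) (b : R) E F phi w (delta : R) :
  b = 0 \/ b = 1 ->
  (forall psi : 'rV[R]_d.+1 -> X,
    {within @bdry R d.+1, continuous psi} ->
    (forall p, bdry p -> ball (F (to_half i b p)) delta (psi p)) ->
    exists Psi : 'rV[R]_d.+1 -> X,
      [/\ {within cube R d.+1, continuous Psi},
          forall p, bdry p -> Psi p = psi p &
          forall p, cube R d.+1 p -> E (F (to_half i b p)) (Psi p)]) ->
  {within @bdry R d.+1, continuous phi} ->
  (forall p, bdry p -> ball (F p) delta (phi p)) ->
  {within cube R d, continuous w} ->
  (forall q, bdry q -> w q = phi (ins i 2^-1 q)) ->
  (forall q, cube R d q -> ball (F (ins i 2^-1 q)) delta (w q)) ->
  exists Psi : 'rV[R]_d.+1 -> X,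
    [/\ {within cube R d.+1, continuous Psi},
        forall p, bdry p ->
          Psi p = replace_face i (1 - b) w (phi \o to_half i b) p &
        forall p, cube R d.+1 p -> E (F (to_half i b p)) (Psi p)].
Proof.
move=> b01 ext cphi nphi cw wphi nw.
have half_wall (p : 'rV[R]_d.+1) : p ord0 i = 1 - b ->
    to_half i b p = ins i 2^-1 (del i p).
  by rewrite /to_half => ->; congr ins; lra.
apply: ext => [|p bp].
  apply: replace_face_continuous => //.
  - by case: b01 => ->; rewrite ?subr0 ?subrr; [right|left].
  - apply: within_continuous_precomp cphi; first exact: to_half_continuous.
    by move=> p; exact: half_open_box.
  - by move=> p cp pb bd /=; rewrite half_wall // wphi.
have [p01 cp h] := (bdry_del i p).1 bp.
rewrite /replace_face; case: eqP => [pb|pb] /=.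
  by rewrite half_wall //; exact: nw.
apply/nphi/half_open_box => //; split; first by case: bp.
rewrite opprB addrC subrK.
case: b01 pb h => -> + [|[|]] //; first by left.
- by rewrite subr0 => /[swap] ->.
- by right.
- by rewrite subrr => /[swap] ->.
- by left.
- by right.
Qed.

(** Bisection: the wall is filled first, with an extension so close to [F] that
    it can be used as a boundary value for both halves. *)
Lemma extends_near_split d (i : 'I_d.+1) E F :
  (forall e : R, 0 < e ->
     extends_near (fun y z => ball y e z) (F \o ins i 2^-1)) ->
  extends_near E (F \o to_half i 0) -> extends_near E (F \o to_half i 1) ->
  extends_near E F.
Proof.
move=> wall [d0 d0_gt0 ext0] [d1 d1_gt0 ext1].
have [|dw dw_gt0 extw] := wall (Num.min d0 d1); first by rewrite lt_min d0_gt0.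
exists (Num.min dw (Num.min d0 d1)); first by rewrite !lt_min dw_gt0 d0_gt0.
move=> phi cphi nphi.
have ins_half q : bdry q -> bdry (ins i (2^-1 : R) q).
  move=> bq; apply/bdry_ins; split; [lra|by case: bq|by right; right].
have [w [cw wphi nw]] : exists w : 'rV[R]_d -> X,
    [/\ {within cube R d, continuous w},
        forall q, bdry q -> w q = phi (ins i 2^-1 q) &
        forall q, cube R d q -> ball (F (ins i 2^-1 q)) (Num.min d0 d1) (w q)].
  apply: (extw (phi \o ins i 2^-1)) => [|q bq].
    apply: within_continuous_precomp cphi => //.
    apply: ins_continuous; first exact: fun_continuous_cst.
    by move=> t; exact: cvg_id.
  by apply: le_ball (nphi _ (ins_half _ bq)); rewrite ge_min lexx.
have near0 p : bdry p -> ball (F p) d0 (phi p).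
  by move=> /nphi; apply: le_ball; rewrite !ge_min lexx !orbT.
have near1 p : bdry p -> ball (F p) d1 (phi p).
  by move=> /nphi; apply: le_ball; rewrite !ge_min lexx !orbT.
have nw0 q : cube R d q -> ball (F (ins i 2^-1 q)) d0 (w q).
  by move=> /nw; apply: le_ball; rewrite ge_min lexx.
have nw1 q : cube R d q -> ball (F (ins i 2^-1 q)) d1 (w q).
  by move=> /nw; apply: le_ball; rewrite ge_min lexx orbT.
have [Phi0 [c0 e0 n0]] :=
  extend_half (or_introl erefl) ext0 cphi near0 cw wphi nw0.
have [Phi1 [c1 e1 n1]] :=
  extend_half (or_intror erefl) ext1 cphi near1 cw wphi nw1.
have cube0 (p : 'rV[R]_d.+1) : cube R d.+1 p -> p ord0 i <= 2^-1 ->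
    cube R d.+1 (from_half i 0 p).
  by move=> /(cube_del i)[/andP[p0 p1] cp] ple; apply/cube_ins; split=> //; lra.
have cube1 (p : 'rV[R]_d.+1) : cube R d.+1 p -> 2^-1 <= p ord0 i ->
    cube R d.+1 (from_half i 1 p).
  by move=> /(cube_del i)[/andP[p0 p1] cp] ple; apply/cube_ins; split=> //; lra.
exists (fun p : 'rV[R]_d.+1 => if p ord0 i <= 2^-1 then Phi0 (from_half i 0 p)
                 else Phi1 (from_half i 1 p)); split.
- apply: within_continuous_le_glue.
  + exact: cube_closed.
  + exact: coord_row_continuous.
  + apply: within_continuous_precomp c0; first exact: from_half_continuous.
    by move=> p [] /=; exact: cube0.
  + apply: within_continuous_precomp c1; first exact: from_half_continuous.
    by move=> p [] /=; exact: cube1.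
  + move=> p /(cube_del i)[p01 cp] ph; rewrite e0 ?e1.
    * rewrite /replace_face /from_half !ins_at !insK !ph.
      have -> : (2 * 2^-1 - 0 : R) = 1 by lra.
      have -> : (2 * 2^-1 - 1 : R) = 0 by lra.
      by rewrite subr0 subrr !eqxx.
    * apply/bdry_ins; rewrite ph; split=> //; first lra.
      by left; lra.
    * apply/bdry_ins; rewrite ph; split=> //; first lra.
      by right; left; lra.
- move=> p bp; have [p01 cp h] := (bdry_del i p).1 bp.
  have wall_p : p ord0 i = 2^-1 -> w (del i p) = phi p.
    move=> ph; rewrite wphi -?ph ?ins_del //.
    by case: h => [p0|[p1|//]]; exfalso; lra.
  case: ifPn => [ple|/negP]; last move/negP; rewrite -?ltNge.
    rewrite e0.
      rewrite /replace_face; case: eqP => [|_]; last by rewrite /= from_halfK.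
      by rewrite /from_half ins_at insK => pe; apply: wall_p; lra.
    apply/bdry_ins; split=> //; first lra.
    by case: h => [->|[p1|]]; [left; lra|exfalso; lra|right; right].
  move=> plt; rewrite e1.
    rewrite /replace_face; case: eqP => [|_]; last by rewrite /= from_halfK.
    by rewrite /from_half ins_at insK => pe; apply: wall_p; lra.
  apply/bdry_ins; split=> //; first lra.
  by case: h => [p0|[->|]]; [exfalso; lra|right; left; lra|right; right].
- move=> p cp; case: ifPn => [ple|/negP]; last move/negP; rewrite -?ltNge.
    by rewrite -{1}(from_halfK i 0 p); apply/n0/cube0.
  move=> plt; rewrite -{1}(from_halfK i 1 p).
  by apply/n1/cube1 => //; exact: ltW.
Qed.

Definition affine d (a s p : 'rV[R]_d) : 'rV[R]_d :=
  \row_j (a ord0 j + s ord0 j * p ord0 j).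

Lemma affine_continuous d (a s : 'rV[R]_d) : continuous (affine a s).
Proof.
apply: row_continuous => j; under eq_fun do rewrite mxE.
apply: fun_continuousD; first exact: fun_continuous_cst.
by apply: fun_continuousM;
  [exact: fun_continuous_cst|exact: coord_row_continuous].
Qed.

Lemma affine_to_half d (a s : 'rV[R]_d.+1) i b :
  affine a s \o to_half i b =
  affine (\row_j (a ord0 j + (j == i)%:R * (s ord0 j * (b / 2))))
         (\row_j if j == i then s ord0 j / 2 else s ord0 j).
Proof.
apply/funext => p; apply/rowP => j; rewrite /affine /to_half /= !mxE.
case: unliftP => [k ->|->] /=.
  by rewrite eq_sym (negbTE (neq_lift _ _)) mxE mul0r addr0.
by rewrite eqxx /= mul1r; field.
Qed.

(** Only small cubes need an argument specific to the space. Every point of the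
    cube has a neighbourhood in which small boxes have the extension property;
    by compactness one size [r] serves everywhere, and a box with sides below
    [r * 2 ^ m j] is reached from such small ones by bisecting [m j] times along
    each coordinate [j]. *)
Lemma extends_near_local d E :
  (forall F : 'rV[R]_d -> X, continuous F -> forall e : R, 0 < e ->
     extends_near (fun y z => ball y e z) F) ->
  (forall y : X, exists2 eta : R, 0 < eta & forall F : 'rV[R]_d.+1 -> X,
     (forall p, cube R d.+1 p -> ball y eta (F p)) -> extends_near E F) ->
  forall F : 'rV[R]_d.+1 -> X, continuous F -> extends_near E F.
Proof.
move=> wall loc F cF.
pose P (r : R) (q : 'rV[R]_d.+1) := forall G : 'rV[R]_d.+1 -> X,
  (forall u, cube R d.+1 u -> exists2 v, ball q r v & G u = F v) ->
  extends_near E G.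
have [r r_gt0 smallP] : exists2 r : R, 0 < r & cube R d.+1 `<=` P r.
  apply: cube_uniform_radius => p _; have [eta eta_gt0 locp] := loc (F p).
  have /nbhs_ballP[rho /= rho_gt0 rhoP] :
    nbhs p (F @^-1` ball (F p) eta) by apply: cF; exact: nbhsx_ballx.
  exists (rho / 2) => [|q r pq /andP[r0 r_lt] G GF]; first by lra.
  apply: locp => u cu; have [v qv ->] := GF u cu; apply: rhoP => /=.
  by apply: (ball_split pq); apply: le_ball qv; exact: ltW.
have small (a s : 'rV[R]_d.+1) :
    (forall j, [/\ 0 <= a ord0 j, 0 <= s ord0 j, a ord0 j + s ord0 j <= 1 &
                   s ord0 j < r]) -> extends_near E (F \o affine a s).
  move=> as_; apply: (smallP a) => [j|u cu].
    by have [? ? ? _] := as_ j; apply/andP; split=> //; lra.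
  exists (affine a s u) => //; split=> // k j; rewrite ord1 mxE.
  have [a0 s0 _ sr] := as_ j; have /andP[u0 u1] := cu j.
  rewrite /ball /= opprD addrA subrr sub0r normrN ger0_norm ?mulr_ge0 //.
  by apply: le_lt_trans sr; rewrite ler_piMr.
have bisect (m : 'I_d.+1 -> nat) (a s : 'rV[R]_d.+1) :
    (forall j, [/\ 0 <= a ord0 j, 0 <= s ord0 j, a ord0 j + s ord0 j <= 1 &
                   s ord0 j < r * 2 ^+ m j]) ->
    extends_near E (F \o affine a s).
  have [M] := ubnP (\sum_j m j); elim: M m a s => // M IH m a s mM as_.
  have [i mi|m0] := pickP (fun j => m j != 0%N); last first.
    apply: small => j; have [? ? ?] := as_ j.
    by have /negbFE/eqP -> := m0 j; rewrite expr0 mulr1.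
  have halves b : b = 0 \/ b = 1 ->
      extends_near E (F \o (affine a s \o to_half i b)).
    move=> b01; rewrite affine_to_half; apply: (IH (fun j => m j - (j == i))%N).
      rewrite -ltnS; apply: leq_trans mM; rewrite ltnS.
      rewrite (bigD1 i) //= [ltnRHS](bigD1 i) //= eqxx -addSn.
      rewrite leq_add //; first by rewrite subn1 prednK // lt0n.
      by apply: leq_sum => j /negbTE ->; rewrite subn0.
    move=> j; rewrite !mxE; have [a0 s0 as1 sr] := as_ j.
    case: eqP => [ji|_] /=; last by rewrite mul0r addr0 subn0.
    move: sr; rewrite mul1r subn1 ji.
    rewrite -[in m i](prednK (n := m i)) ?lt0n // exprS mulrCA => sr.
    rewrite ji in a0 s0 as1.
    by move: (r * _) sr => y sr; case: b01 => ->; split; lra.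
  apply: (@extends_near_split _ i); [|exact: halves (or_introl erefl)|
    exact: halves (or_intror erefl)].
  move=> e e_gt0; apply: wall => // q; apply: continuous_comp => /=.
    apply: ins_continuous; first exact: fun_continuous_cst.
    by move=> t; exact: cvg_id.
  by apply: continuous_comp; [exact: affine_continuous|exact: cF].
have -> : F = F \o affine (const_mx 0) (const_mx 1).
  apply/funext => p /=; congr F; apply/rowP => j.
  by rewrite !mxE add0r mul1r.
apply: (bisect (fun=> Num.bound r^-1)) => j; rewrite !mxE add0r; split=> //.
by rewrite -ltr_pdivrMl // mulr1; exact: upper_nthrootP.
Qed.

End extension.

(** * The cube as a cone over its boundary *)

Section cone.
Variable R : realType.
Implicit Types n : nat.

Lemma rV_norm_le n (v : 'rV[R]_n) (c : R) : 0 <= c ->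
  `|v| <= c <-> forall j, `|v ord0 j| <= c.
Proof.
move=> c0; split=> [vc j|vc].
  apply: le_trans vc; rewrite /Num.norm /= mx_normrE.
  exact: (le_bigmax _ (fun ij : 'I_1 * 'I_n => `|v ij.1 ij.2|) (ord0, j)).
rewrite /Num.norm /= mx_normrE; apply: bigmax_le => // -[i j] _ /=.
by rewrite ord1.
Qed.

Lemma rV_norm_attained n (v : 'rV[R]_n) :
  `|v| != 0 -> exists j, `|v| = `|v ord0 j|.
Proof. by move=> /mx_norm_neq0[[i j] /=]; rewrite ord1 => vj; exists j. Qed.

Lemma rV_norm_ins n (i : 'I_n.+1) (c : R) (q : 'rV[R]_n) :
  `|ins i c q| = Num.max `|c| `|q|.
Proof.
apply/le_anti/andP; split.
  apply/rV_norm_le => [|j]; first by rewrite le_max normr_ge0.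
  rewrite mxE le_max; case: unliftP => [k _|_] /=; last by rewrite lexx.
  by apply/orP; right; exact: (rV_norm_le _ (normr_ge0 q)).1.
have insP := (rV_norm_le (ins i c q) (normr_ge0 _)).1 (lexx _).
rewrite ge_max; apply/andP; split; first by have := insP i; rewrite ins_at.
by apply/rV_norm_le => [|j]; [exact: normr_ge0|
  have := insP (lift i j); rewrite ins_lift].
Qed.

Definition centered n (u : 'rV[R]_n) : 'rV[R]_n := 2 *: u - const_mx 1.
Definition uncentered n (v : 'rV[R]_n) : 'rV[R]_n := 2^-1 *: (v + const_mx 1).

Lemma uncenteredK n : cancel (@uncentered n) (@centered n).
Proof. by move=> v; apply/rowP => j; rewrite !mxE; field. Qed.

Lemma centeredK n : cancel (@centered n) (@uncentered n).
Proof. by move=> v; apply/rowP => j; rewrite !mxE; field. Qed.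

Lemma cube_centered n (u : 'rV[R]_n) : cube R n u <-> `|centered u| <= 1.
Proof.
rewrite rV_norm_le //; split=> cu j; have := cu j; rewrite !mxE ler_norml.
  by move=> /andP[? ?]; apply/andP; split; lra.
by move=> /andP[? ?]; apply/andP; split; lra.
Qed.

Lemma bdry_centered n (u : 'rV[R]_n) : bdry u <-> `|centered u| = 1.
Proof.
split=> [[cu [i ui]]|u1].
  apply/le_anti/andP; split; first exact/cube_centered.
  apply: le_trans ((rV_norm_le (centered u) (normr_ge0 _)).1 (lexx _) i).
  rewrite !mxE; case: ui => ->; rewrite ?mulr0 ?sub0r ?normrN ?normr1 //.
  by rewrite mulr1 -[2]/(1 + 1) addrK normr1.
split; first by apply/cube_centered; rewrite u1.
have [|i ui] := @rV_norm_attained _ (centered u); first by rewrite u1 oner_eq0.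
exists i; move: ui; rewrite u1 !mxE => /esym/eqP.
by rewrite eqr_norml ler01 andbT => /orP[]/eqP h; [right|left]; lra.
Qed.

Lemma scale_continuous (T : topologicalType) n (c : T -> R)
    (f : T -> 'rV[R]_n) :
  continuous c -> continuous f -> continuous (fun t => c t *: f t).
Proof. by move=> cc cf t; apply: cvgZ; [exact: cc|exact: cf]. Qed.

Lemma centered_continuous (T : topologicalType) n (f : T -> 'rV[R]_n) :
  continuous f -> continuous (fun t => centered (f t)).
Proof.
move=> cf t; apply: cvgB; last exact: cvg_cst.
by apply: scale_continuous cf t; exact: fun_continuous_cst.
Qed.

Lemma uncentered_continuous (T : topologicalType) n (f : T -> 'rV[R]_n) :
  continuous f -> continuous (fun t => uncentered (f t)).
Proof.
move=> cf; apply: scale_continuous; first exact: fun_continuous_cst.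
by move=> t; apply: cvgD; [exact: cf|exact: cvg_cst].
Qed.

Lemma norm_rV_continuous (T : topologicalType) n (f : T -> 'rV[R]_n) :
  continuous f -> continuous (fun t => `|f t|).
Proof. by move=> cf t; apply: cvg_norm; exact: cf. Qed.

(** [wrap] maps the ball [|v| <= 1] onto the sphere one dimension up, closing
    it up like a bag: with [r = |v|], the part [r <= 1/3] covers the bottom face
    of the cube, [1/3 <= r <= 2/3] the sides, and [2/3 <= r <= 1] the top face,
    the whole sphere [r = 1] going to the centre of the top face. *)
Definition wrap_height (r : R) : R := Num.max (-1) (Num.min 1 (6 * r - 3)).
Definition wrap_scale (r : R) : R :=
  Num.min 1 (3 * (1 - r)) / Num.max r 3^-1.
Definition wrap n (v : 'rV[R]_n) : 'rV[R]_n.+1 :=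
  ins ord0 (wrap_height `|v|) (wrap_scale `|v| *: v).

Lemma wrap_bottom (r : R) : r <= 3^-1 -> wrap_height r = -1 /\ wrap_scale r = 3.
Proof.
move=> r3; rewrite /wrap_height /wrap_scale; split.
  by apply/max_idPl; rewrite ge_min; apply/orP; right; lra.
have -> : Num.min 1 (3 * (1 - r)) = 1 by apply/min_idPl; lra.
by rewrite (max_idPr r3) div1r invrK.
Qed.

Lemma wrap_side (r : R) : 3^-1 <= r <= 2 / 3 ->
  wrap_height r = 6 * r - 3 /\ wrap_scale r = r^-1.
Proof.
move=> /andP[r1 r2]; rewrite /wrap_height /wrap_scale; split.
  have -> : Num.min 1 (6 * r - 3) = 6 * r - 3 by apply/min_idPr; lra.
  by apply/max_idPr; lra.
have -> : Num.min 1 (3 * (1 - r)) = 1 by apply/min_idPl; lra.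
by rewrite (max_idPl r1) div1r.
Qed.

Lemma wrap_top (r : R) : 2 / 3 <= r ->
  wrap_height r = 1 /\ wrap_scale r = 3 * (1 - r) / r.
Proof.
move=> r1; rewrite /wrap_height /wrap_scale; split.
  have -> : Num.min 1 (6 * r - 3) = 1 by apply/min_idPl; lra.
  by apply/max_idPr; lra.
have -> : Num.min 1 (3 * (1 - r)) = 3 * (1 - r) by apply/min_idPr; lra.
by have -> : Num.max r 3^-1 = r by apply/max_idPl; lra.
Qed.

(** The last index is the norm of [wrap_scale r *: v] when [r = |v|]. *)
Variant wrap_spec (r : R) : R -> R -> R -> Type :=
| WrapBottom of 0 <= r <= 3^-1 : wrap_spec r (-1) 3 (3 * r)
| WrapSide of 3^-1 <= r <= 2 / 3 : wrap_spec r (6 * r - 3) r^-1 1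
| WrapTop of 2 / 3 <= r <= 1 : wrap_spec r 1 (3 * (1 - r) / r) (3 * (1 - r)).

Lemma wrapP (r : R) : 0 <= r <= 1 ->
  wrap_spec r (wrap_height r) (wrap_scale r) (`|wrap_scale r| * r).
Proof.
move=> /andP[r0 r1]; have [r3|r3] := leP r 3^-1.
  have [-> ->] := wrap_bottom r3; rewrite ger0_norm //.
  by constructor; rewrite r0.
have rgt0 : 0 < r by apply: lt_trans r3; rewrite invr_gt0.
have [r4|r4] := leP r (2 / 3).
  have r34 : 3^-1 <= r <= 2 / 3 by rewrite ltW.
  have [-> ->] := wrap_side r34.
  by rewrite ger0_norm ?invr_ge0 // mulVf ?gt_eqF //; constructor.
have [-> ->] := wrap_top (ltW r4); rewrite ger0_norm.
  by rewrite divfK ?gt_eqF //; constructor; rewrite ltW.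
by apply: divr_ge0 => //; lra.
Qed.

Lemma wrap_height_cont (T : topologicalType) (f : T -> R) :
  continuous f -> continuous (fun t => wrap_height (f t)).
Proof.
move=> cf; apply: fun_continuous_max; first exact: fun_continuous_cst.
apply: fun_continuous_min; first exact: fun_continuous_cst.
apply: fun_continuousB; last exact: fun_continuous_cst.
by apply: fun_continuousM => //; exact: fun_continuous_cst.
Qed.

Lemma wrap_scale_cont (T : topologicalType) (f : T -> R) :
  continuous f -> continuous (fun t => wrap_scale (f t)).
Proof.
move=> cf; apply: fun_continuousM.
  apply: fun_continuous_min; first exact: fun_continuous_cst.
  apply: fun_continuousM; first exact: fun_continuous_cst.
  by apply: fun_continuousB => //; exact: fun_continuous_cst.
apply: fun_continuousV.
  by move=> t; rewrite gt_eqF // lt_max invr_gt0 ltr0n orbT.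
by apply: fun_continuous_max => //; exact: fun_continuous_cst.
Qed.

Lemma wrap_continuous (T : topologicalType) n (f : T -> 'rV[R]_n) :
  continuous f -> continuous (fun t => wrap (f t)).
Proof.
move=> cf; apply: ins_continuous.
  exact/wrap_height_cont/norm_rV_continuous.
by apply: scale_continuous => //; exact/wrap_scale_cont/norm_rV_continuous.
Qed.

Lemma norm_wrap n (v : 'rV[R]_n) : `|v| <= 1 -> `|wrap v| = 1.
Proof.
move=> v1; rewrite rV_norm_ins normrZ; case: wrapP => [|||].
- by rewrite normr_ge0.
- by move=> /andP[r0 r3]; rewrite normrN normr1; apply/max_idPl; lra.
- move=> /andP[r3 r4]; apply/max_idPr; rewrite ler_norml; apply/andP.
  by split; lra.
- by move=> /andP[r4 r1]; rewrite normr1; apply/max_idPl; lra.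
Qed.

Lemma wrap_boundary n (v v' : 'rV[R]_n) :
  `|v| = 1 -> `|v'| = 1 -> wrap v = wrap v'.
Proof.
move=> v1 v'1; rewrite /wrap v1 v'1; congr ins.
have [_ ->] := @wrap_top 1 (ltac:(lra)).
by rewrite subrr mulr0 mul0r !scale0r.
Qed.

(** The pair formed by the height and by the norm of the horizontal part
    determines [r], and [wrap_scale r] vanishes for [r = 1] only. *)
Lemma wrap_inj n (v v' : 'rV[R]_n) : `|v| <= 1 -> `|v'| <= 1 ->
  wrap v = wrap v' -> v = v' \/ `|v| = 1 /\ `|v'| = 1.
Proof.
move=> v1 v'1 vv'.
have hh : wrap_height `|v| = wrap_height `|v'|.
  by have := congr1 (fun w : 'rV__ => w ord0 ord0) vv'; rewrite !ins_at.
have ss : wrap_scale `|v| *: v = wrap_scale `|v'| *: v'.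
  by have := congr1 (@del _ _ ord0) vv'; rewrite !insK.
have nn : `|wrap_scale `|v| | * `|v| = `|wrap_scale `|v'| | * `|v'|.
  by rewrite -[LHS]normrZ -[RHS]normrZ ss.
suff [rr|b] : `|v| = `|v'| /\ wrap_scale `|v| != 0 \/ `|v| = 1 /\ `|v'| = 1.
- by left; move: ss; rewrite -rr.1 => /(scalerI rr.2).
- by right.
move: hh nn.
have r01 := normr_ge0 v; have r'01 := normr_ge0 v'.
have vI : 0 <= `|v| <= 1 by rewrite r01.
have v'I : 0 <= `|v'| <= 1 by rewrite r'01.
move: vI v'I; move: `|v| `|v'| => r r'; clear => rI r'I.
case: (wrapP rI) => /andP[r0 r1]; case: (wrapP r'I) => /andP[r'0 r'1] hh ss.
- by left; split; [lra|rewrite pnatr_eq0].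
- by left; split; [lra|rewrite pnatr_eq0].
- by exfalso; lra.
- by left; split; [lra|rewrite invr_eq0 gt_eqF //; lra].
- by left; split; [lra|rewrite invr_eq0 gt_eqF //; lra].
- by left; split; [lra|rewrite invr_eq0 gt_eqF //; lra].
- by exfalso; lra.
- left; split; first by lra.
  have rgt0 : 0 < r by lra.
  by apply: lt0r_neq0; apply: divr_gt0 => //; lra.
- have [r1e|rn1] := eqVneq r 1; first by right; split=> //; lra.
  left; split; first by lra.
  have rgt0 : 0 < r by lra.
  have rlt1 : r < 1 by rewrite lt_neqAle rn1.
  by apply: lt0r_neq0; apply: divr_gt0 => //; lra.
Qed.

(** Positive dimension is needed: the centre of the top face is only reached
    from vectors of norm 1. *)
Lemma wrap_onto n (w : 'rV[R]_n.+2) : `|w| = 1 ->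
  exists2 v : 'rV[R]_n.+1, `|v| <= 1 & wrap v = w.
Proof.
rewrite -(ins_del ord0 w); set c := w ord0 ord0; set q := del ord0 w.
rewrite rV_norm_ins => w1.
have c1 : `|c| <= 1 by rewrite -w1 le_max lexx.
have q1 : `|q| <= 1 by rewrite -w1 le_max lexx orbT.
have qge0 := normr_ge0 q.
have wrap_ray r : 0 <= r <= 1 -> `|q| != 0 -> wrap_height r = c ->
    wrap_scale r * r = `|q| ->
    exists2 v : 'rV[R]_n.+1, `|v| <= 1 & wrap v = ins ord0 c q.
  move=> /andP[r0 r1] qn0 hr sr; exists ((r / `|q|) *: q).
    by rewrite normrZ normrM normfV normr_id divfK // ger0_norm.
  rewrite /wrap normrZ normrM normfV normr_id divfK // ger0_norm // hr.
  by rewrite scalerA mulrA sr divff // scale1r.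
have [cN1|cn] := eqVneq c (-1).
  exists (3^-1 *: q).
    by rewrite normrZ ger0_norm ?invr_ge0 //; lra.
  rewrite /wrap normrZ (ger0_norm (_ : 0 <= 3^-1)) ?invr_ge0 //.
  have [|-> ->] := @wrap_bottom (3^-1 * `|q|); first by lra.
  by rewrite scalerA divff ?scale1r ?cN1 ?pnatr_eq0.
have [c1e|cn1] := eqVneq c 1.
  have [q0|qn0] := eqVneq `|q| 0.
    have nc : `|const_mx 1 : 'rV[R]_n.+1| = 1.
      apply/le_anti/andP; split.
        by apply/rV_norm_le => // j; rewrite mxE normr1.
      have := (rV_norm_le (const_mx 1 : 'rV[R]_n.+1) (normr_ge0 _)).1
        (lexx _) ord0.
      by rewrite mxE normr1.
    exists (const_mx 1); first by rewrite nc.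
    rewrite /wrap nc; have [|-> ->] := @wrap_top 1; first by lra.
    by rewrite subrr mulr0 mul0r scale0r c1e (normr0_eq0 q0).
  apply: (wrap_ray (1 - `|q| / 3)) => //; first by apply/andP; split; lra.
    by have [|-> _] := @wrap_top (1 - `|q| / 3); first by lra.
  have [|_ ->] := @wrap_top (1 - `|q| / 3); first by lra.
  by rewrite divfK; [lra|rewrite gt_eqF //; lra].
have qe1 : `|q| = 1.
  move: w1; rewrite /Num.max; case: ifP => // _ /eqP.
  by rewrite eqr_norml (negbTE cn) (negbTE cn1).
move: c1; rewrite ler_norml => /andP[c0 c1].
apply: (wrap_ray ((c + 3) / 6)).
- by apply/andP; split; lra.
- by rewrite qe1 oner_eq0.
- by have [|-> _] := @wrap_side ((c + 3) / 6); [apply/andP; split|]; lra.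
- have [|_ ->] := @wrap_side ((c + 3) / 6); first by apply/andP; split; lra.
  by rewrite mulVf ?qe1 // gt_eqF //; lra.
Qed.

(** [cone (t, -)] covers the sphere of radius [1 - t] around the centre of the
    cube, so that the cylinder is mapped onto the cube. *)
Definition cone n (tu : R * 'rV[R]_n) : 'rV[R]_n.+1 :=
  uncentered ((1 - tu.1) *: wrap (centered tu.2)).

Lemma cone_continuous n : continuous (@cone n).
Proof.
apply: uncentered_continuous; apply: scale_continuous.
  apply: fun_continuousB; first exact: fun_continuous_cst.
  by move=> t; exact: cvg_fst.
by apply/wrap_continuous/centered_continuous => t; exact: cvg_snd.
Qed.

Lemma norm_cone n t (u : 'rV[R]_n) : t <= 1 -> cube R n u ->
  `|centered (cone (t, u))| = 1 - t.
Proof.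
move=> t1 /cube_centered cu; rewrite uncenteredK normrZ norm_wrap //= mulr1.
by rewrite ger0_norm // subr_ge0.
Qed.

Lemma cone_base n (u : 'rV[R]_n) : cube R n u -> bdry (cone (0, u)).
Proof. by move=> cu; apply/bdry_centered; rewrite norm_cone // subr0. Qed.

Lemma cone_boundary n t (u u' : 'rV[R]_n) : bdry u -> bdry u' ->
  cone (t, u) = cone (t, u').
Proof.
move=> /bdry_centered cu /bdry_centered cu'.
by rewrite /cone /= (wrap_boundary cu cu').
Qed.

Lemma cone_inj n t t' (u u' : 'rV[R]_n) : t <= 1 -> t' <= 1 ->
  cube R n u -> cube R n u' -> cone (t, u) = cone (t', u') ->
  t = t' /\ [\/ t = 1, u = u' | bdry u /\ bdry u'].
Proof.
move=> t1 t'1 cu cu' e.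
have tt' : t = t'.
  have := congr1 (fun p => `|centered p|) e; rewrite /= !norm_cone //; lra.
split=> //; have [t1e|t1n] := eqVneq t 1; first by constructor 1.
move: e; rewrite -tt' => /(can_inj (@uncenteredK _)) /= /scalerI.
move=> /(_ (ltac:(by rewrite subr_eq0 eq_sym))) /wrap_inj.
move/cube_centered: cu => cu; move/cube_centered: cu' => cu'.
move=> /(_ cu cu')[uu'|[b b']].
  by constructor 2; exact: (can_inj (@centeredK n)).
by constructor 3; split; exact/bdry_centered.
Qed.

Lemma cone_onto n (p : 'rV[R]_n.+2) : cube R n.+2 p ->
  exists tu : R * 'rV[R]_n.+1,
    [/\ 0 <= tu.1 <= 1, cube R n.+1 tu.2 & cone tu = p].
Proof.
move=> /cube_centered cp; have [p0|pn0] := eqVneq (centered p) 0.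
  exists (1, 0) => /=; split; first by rewrite ler01 lexx.
    by move=> j; rewrite mxE lexx ler01.
  by rewrite /cone /= subrr scale0r -p0 centeredK.
have np : `|centered p| != 0 by rewrite normr_eq0.
have [|v v1 vp] := @wrap_onto n (`|centered p|^-1 *: centered p).
  by rewrite normrZ normfV normr_id mulVf.
exists (1 - `|centered p|, uncentered v) => /=; split.
- by rewrite subr_ge0 cp gerBl normr_ge0.
- by apply/cube_centered; rewrite uncenteredK.
- rewrite /cone /= uncenteredK vp opprB addrC subrK scalerA divff // scale1r.
  exact: centeredK.
Qed.

End cone.

(** * From homotopy groups to extensions over cubes *)

Section sphere_extension.
Variable R : realType.

Lemma within_continuous_val (T X : topologicalType) (A : set T) (f : T -> X) :
  {within A, continuous f} -> continuous (fun a : A => f (\val a)).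
Proof.
move=> /subspace_continuousP cf a W fW.
have Aa : A (\val a) by move/set_mem: (valP a).
have := @continuous_set_val T A a _ (cf _ Aa W fW).
rewrite !nbhs_simpl /=; apply: filterS => b /= Wb; apply: Wb.
by move/set_mem: (valP b).
Qed.

(** The default value [v0] is used outside [A] only. *)
Lemma within_continuous_lift (T X : topologicalType) (A : set T) (V : set X)
    (v0 : V) (f : T -> X) :
  {within A, continuous f} -> (forall t, A t -> V (f t)) ->
  exists g : T -> V, {within A, continuous g} /\
    forall t, A t -> \val (g t) = f t.
Proof.
move=> cf AV.
pose g t : V := if pselect (V (f t)) is left h then exist _ (f t) (mem_set h)
                else v0.
have gf t : A t -> \val (g t) = f t.
  by move=> /AV Vf; rewrite /g; case: pselect.
exists g; split=> //.
apply: (@continuous_to_set X (subspace A) V g).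
by apply: within_continuous_eq cf => t /gf.
Qed.

(** The extension problem for a map on the boundary of a cube is a problem about
    maps out of the cylinder over a cube of lower dimension, since the former
    cube is the quotient of that cylinder by [cone]. *)
Lemma extend_from_cylinder n (Z : topologicalType) (phi : 'rV[R]_n.+2 -> Z)
    (G : R * 'rV[R]_n.+1 -> Z) :
  continuous G ->
  (forall u, cube R n.+1 u -> G (0, u) = phi (cone (0, u))) ->
  (forall t u u', 0 <= t <= 1 -> bdry u -> bdry u' -> G (t, u) = G (t, u')) ->
  (forall u u', cube R n.+1 u -> cube R n.+1 u' -> G (1, u) = G (1, u')) ->
  exists Phi : 'rV[R]_n.+2 -> Z,
    {within cube R n.+2, continuous Phi} /\ forall p, bdry p -> Phi p = phi p.
Proof.
move=> cG G0 Gb G1.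
have /choice[g gP] : forall p : 'rV[R]_n.+2, exists tu : R * 'rV[R]_n.+1,
    cube R n.+2 p -> [/\ 0 <= tu.1 <= 1, cube R n.+1 tu.2 & cone tu = p].
  move=> p; have [cp|ncp] := pselect (cube R n.+2 p).
    by have [tu tuP] := cone_onto cp; exists tu.
  by exists (0, 0).
pose K : set (R * 'rV[R]_n.+1) := `[0, 1] `*` cube R n.+1.
have KP tu : K tu <-> 0 <= tu.1 <= 1 /\ cube R n.+1 tu.2.
  by rewrite /K /setX /= in_itv.
have PhiK tu : K tu -> G (g (cone tu)) = G tu.
  case: tu => t u /KP[/= /andP[t0 t1] cu].
  have [|] := gP (cone (t, u)).
    by apply/cube_centered; rewrite norm_cone // gerBl.
  case: (g _) => t' u' /= /andP[t'0 t'1] cu' e.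
  have [-> h] := cone_inj t'1 t1 cu' cu e.
  case: h => [->|->//|[bu' bu]]; first exact: G1.
  by apply: Gb => //; rewrite t0.
exists (G \o g); split.
  apply: (@within_continuous_sub _ _ _ (@cone R n.+1 @` K)).
    move=> p /gP[t01 cu <-]; exists (g p) => //; exact/KP.
  apply: (within_continuous_quotient (@norm_hausdorff _ _) _
    (@cone_continuous R n.+1) cG) => //.
  apply: compact_setX; [exact: segment_compact|exact: cube_compact].
move=> p bp /=; have [|] := gP p; first by case: bp.
case: (g p) => t u /= /andP[t0 t1] cu e.
have t0e : t = 0.
  by have /bdry_centered := bp; rewrite -e norm_cone //; lra.
by rewrite t0e G0 // -t0e e.
Qed.

Definition dilate n (c : R) (u : 'rV[R]_n) : 'rV[R]_n :=
  uncentered (c *: centered u : 'rV[R]_n).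

Lemma dilateK n (c d : R) (u : 'rV[R]_n) :
  c * d = 1 -> dilate c (dilate d u) = u.
Proof.
by move=> cd; rewrite /dilate uncenteredK scalerA cd scale1r centeredK.
Qed.

Lemma norm_dilate n (c : R) (u : 'rV[R]_n) : 0 <= c ->
  `|centered (dilate c u)| = c * `|centered u|.
Proof. by move=> c0; rewrite uncenteredK normrZ ger0_norm. Qed.

Lemma dilate_continuous (T : topologicalType) n (c : T -> R)
    (f : T -> 'rV[R]_n) :
  continuous c -> continuous f -> continuous (fun t => dilate (c t) (f t)).
Proof.
move=> cc cf; apply: uncentered_continuous; apply: scale_continuous => //.
exact: centered_continuous.
Qed.

(** Where [cone (0, -)] sends the whole boundary. *)
Definition apex n : 'rV[R]_n.+2 := cone (0, 0 : 'rV[R]_n.+1).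

Lemma cone_apex n (u : 'rV[R]_n.+1) : bdry u -> cone (0, u) = apex n.
Proof.
move=> bu; apply: cone_boundary => //; split.
  by move=> j; rewrite mxE lexx ler01.
by exists ord0; left; rewrite mxE.
Qed.

(** A loop based at [y] is made of [phi], put on the concentric cube of half the
    size, and of the path [gamma] run outwards in the remaining collar. The
    cylinder first enlarges that concentric cube to the whole, so that the
    boundary runs along [gamma], and then follows a null homotopy. *)
Lemma extend_sphere n (Y Z : topologicalType) (h : Y -> Z) (ch : continuous h)
    (y : Y) (phi : 'rV[R]_n.+2 -> Y) (gamma : R -> Y) :
  trivial_homotopy_map R n.+1 ch y ->
  {within @bdry R n.+2, continuous phi} ->
  continuous gamma -> gamma 0 = phi (apex n) -> gamma 1 = y ->
  exists Phi : 'rV[R]_n.+2 -> Z,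
    {within cube R n.+2, continuous Phi} /\
    forall p, bdry p -> Phi p = h (phi p).
Proof.
move=> triv cphi cgamma gamma0 gamma1.
pose rho (u : 'rV[R]_n.+1) := `|centered u|.
have crho : continuous rho.
  by apply/norm_rV_continuous/centered_continuous => u; exact: cvg_id.
pose L u := if rho u <= 2^-1 then phi (cone (0, dilate 2 u))
            else gamma (2 * rho u - 1).
have rho_dilate c u : 0 <= c -> rho (dilate c u) = c * rho u.
  exact: norm_dilate.
have cube_dilate c u : 0 <= c <= 1 -> cube R n.+1 u -> cube R n.+1 (dilate c u).
  move=> /andP[c0 c1] /cube_centered cu; apply/cube_centered.
  by rewrite norm_dilate //; apply: mulr_ile1.
have cube_dilate2 u : rho u <= 2^-1 -> cube R n.+1 (dilate 2 u).
  by move=> ru; apply/cube_centered; rewrite -/(rho _) rho_dilate //; lra.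
have cL : {within cube R n.+1, continuous L}.
  apply: within_continuous_le_glue => //.
  - exact: cube_closed.
  - have c0 : continuous (fun u : 'rV[R]_n.+1 => cone (0, dilate 2 u)).
      apply: continuous_composed; last exact: cone_continuous.
      apply: continuous_pair; first exact: fun_continuous_cst.
      apply: dilate_continuous; first exact: fun_continuous_cst.
      by move=> w; exact: cvg_id.
    apply: within_continuous_precomp cphi => //.
    by move=> u [_ /= ru]; apply/cone_base/cube_dilate2.
  - apply: continuous_subspaceT; apply: continuous_composed cgamma.
    apply: fun_continuousB; last exact: fun_continuous_cst.
    by apply: fun_continuousM => //; exact: fun_continuous_cst.
  - move=> u cu ru; rewrite cone_apex ?ru ?divff ?subrr //.
    by apply/bdry_centered; rewrite -/(rho _) rho_dilate // ru divff.
have L_collar u : 2^-1 <= rho u -> L u = gamma (2 * rho u - 1).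
  rewrite /L => ru; case: ifPn => // ru'.
  have ru2 : rho u = 2^-1 by apply/le_anti; rewrite ru ru'.
  rewrite ru2 divff // subrr gamma0 cone_apex //.
  by apply/bdry_centered; rewrite -/(rho _) rho_dilate // ru2 divff.
have L_bdry (u : cube R n.+1) : cube_boundary u -> L (\val u) = y.
  move=> /cube_boundary_bdry/bdry_centered ru.
  rewrite L_collar /rho ru; last lra.
  by rewrite -[RHS]gamma1; congr gamma; lra.
pose loop := @NLoop R n.+1 Y y _ (within_continuous_val cL) L_bdry.
have [H [cH H0 H1 Hb]] :
    homotopic (comp_nloop ch loop) (cst_nloop R n.+1 (h y)).
  apply/homotopy_group_eqP; rewrite -homotopy_map_pi; exact: triv.
(* For [t <= 1/2] the first argument of [H] stays at 0 while the dilation grows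
   from 1/2 to 1; afterwards the dilation is 1 and [H] runs from 0 to 1. *)
pose G (tu : R * 'rV[R]_n.+1) := H (itv_retr (Num.max 0 (2 * tu.1 - 1)),
  cube_retr (dilate (Num.min 1 (2^-1 + tu.1)) tu.2)).
have G_early t u : 0 <= t <= 2^-1 -> cube R n.+1 u ->
    G (t, u) = h (L (dilate (2^-1 + t) u)).
  move=> /andP[t0 t1] cu; rewrite /G H0; last first.
    have -> : Num.max 0 (2 * (t, u).1 - 1) = 0 by apply/max_idPl => /=; lra.
    by rewrite itv_retr_val // lexx ler01.
  rewrite -[LHS]/(h (L (\val (cube_retr (dilate (Num.min 1 (2^-1 + t)) u))))).
  have -> : Num.min 1 (2^-1 + t) = 2^-1 + t by apply/min_idPr; lra.
  by rewrite cube_retr_val //; apply: cube_dilate => //; apply/andP; split; lra.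
have G_late t u : 2^-1 <= t <= 1 -> bdry u -> G (t, u) = h y.
  move=> /andP[t0 t1] bu; apply: Hb; apply: cube_boundary_retr => /=.
  rewrite (min_idPl _); last lra.
  by rewrite /dilate scale1r centeredK.
apply: (@extend_from_cylinder n Z (h \o phi) G).
- apply: continuous_composed cH; apply: continuous_pair.
    apply: continuous_composed; last exact: itv_retr_continuous.
    apply: fun_continuous_max; first exact: fun_continuous_cst.
    apply: fun_continuousB; last exact: fun_continuous_cst.
    apply: fun_continuousM; first exact: fun_continuous_cst.
    by move=> ?; exact: cvg_fst.
  apply: continuous_composed; last exact: cube_retr_continuous.
  apply: dilate_continuous; last by move=> ?; exact: cvg_snd.
  apply: fun_continuous_min; first exact: fun_continuous_cst.
  apply: fun_continuousD; first exact: fun_continuous_cst.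
  by move=> ?; exact: cvg_fst.
- move=> u cu; rewrite G_early //; last by apply/andP; split; lra.
  rewrite addr0 /L rho_dilate ?invr_ge0 // ifT.
    by rewrite dilateK // divff.
  by have /cube_centered := cu; rewrite /rho; lra.
- move=> t u u' /andP[t0 t1] bu bu'; have [t2|t2] := leP t 2^-1; last first.
    by rewrite !G_late // t1 ltW.
  have ru : rho u = 1 by exact/bdry_centered.
  have ru' : rho u' = 1 by exact/bdry_centered.
  have c0 : 0 <= 2^-1 + t by lra.
  rewrite !G_early ?t0 //; [|by case: bu'|by case: bu].
  by rewrite !L_collar !rho_dilate ?ru ?ru' //; lra.
- move=> u u' cu cu'; rewrite /G /= !H1 //=;
    by rewrite (max_idPr _) ?clampK //; lra.
Qed.

(** The cube of dimension zero is a point with empty boundary, so that a null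
    homotopy of a loop of dimension zero is a path. *)
Lemma path_of_trivial_pi0 (Y Z : topologicalType) (h : Y -> Z)
    (ch : continuous h) (a b : Y) :
  trivial_homotopy_map R 0 ch b ->
  exists gamma : R -> Z, [/\ continuous gamma, gamma 0 = h a & gamma 1 = h b].
Proof.
move=> triv.
have no_bdry (u : cube R 0) : cube_boundary u -> cst a u = b by case=> -[].
pose loop := @NLoop R 0 Y b (cst a) (@cst_continuous _ _ a) no_bdry.
have [H [cH H0 H1 _]] : homotopic (comp_nloop ch loop) (cst_nloop R 0 (h b)).
  apply/homotopy_group_eqP; rewrite -homotopy_map_pi; exact: triv.
exists (fun t => H (itv_retr t, cube_retr 0)); split.
- apply: continuous_composed cH; apply: continuous_pair.
    exact: itv_retr_continuous.
  by move=> t; exact: cvg_cst.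
- by rewrite H0 //= clampK // lexx ler01.
- by rewrite H1 //= clampK // lexx ler01.
Qed.

End sphere_extension.

(** * Extension over cubes in locally connected spaces *)

Section local_extension.
Variable R : realType.

Lemma within_continuous_postcomp (T Y Z : topologicalType) (A : set T)
    (f : T -> Y) (g : Y -> Z) :
  {within A, continuous f} -> continuous g -> {within A, continuous (g \o f)}.
Proof.
move=> cf cg; exact: (@continuous_composed (subspace A) Y Z f g cf cg).
Qed.

Lemma within_continuous_total (S T Y : topologicalType) (B : set T)
    (h : S -> T) (g : T -> Y) :
  {within B, continuous g} -> continuous h -> (forall s, B (h s)) ->
  continuous (fun s => g (h s)).
Proof.
move=> cg ch hB; apply/continuous_subspace_setT.
by apply: within_continuous_precomp cg.
Qed.

Lemma bdry_const n (c : R) : c = 0 \/ c = 1 -> bdry (const_mx c : 'rV[R]_n.+1).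
Proof.
move=> c01; split; last by exists ord0; rewrite mxE.
by move=> j; rewrite mxE; case: c01 => ->; rewrite ?lexx ?ler01.
Qed.

Lemma extend_trivial_incl k (X : topologicalType) (V U : set X) (VU : V `<=` U)
    (phi : 'rV[R]_k.+1 -> X) :
  (forall (j : nat) (v : V), (j <= k)%N ->
     trivial_homotopy_map R j (@set_incl_continuous X V U VU) v) ->
  {within @bdry R k.+1, continuous phi} -> (forall p, bdry p -> V (phi p)) ->
  exists Phi : 'rV[R]_k.+1 -> X,
    [/\ {within cube R k.+1, continuous Phi},
        forall p, bdry p -> Phi p = phi p & forall p, U (Phi p)].
Proof.
move=> triv cphi phiV.
have v0 : V := exist (fun z => z \in V) _
  (mem_set (phiV _ (bdry_const k (or_introl erefl)))).
have [g [cg gphi]] := within_continuous_lift v0 cphi phiV.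
have valU (u : U) : U (\val u) by move/set_mem: (valP u).
case: k phi triv cphi phiV v0 g cg gphi => [|k] phi triv cphi phiV v0 g cg gphi.
  have [gamma [cgamma gamma0 gamma1]] :=
    path_of_trivial_pi0 (g (const_mx 0)) (triv 0%N (g (const_mx 1)) isT).
  exists (fun p => \val (gamma (p ord0 ord0))); split=> //.
    apply: continuous_subspaceT; apply: continuous_composed.
      by apply: continuous_composed cgamma; exact: coord_row_continuous.
    exact: continuous_set_val.
  move=> p [_ [i pi]].
  have pE c : p ord0 i = c -> p = const_mx c.
    by move=> pc; apply/rowP => j; rewrite mxE -pc !ord1.
  case: pi => /pE ->; rewrite mxE.
    by rewrite gamma0 -gphi //; apply: bdry_const; left.
  by rewrite gamma1 -gphi //; apply: bdry_const; right.
have [Phi [cPhi Phig]] := extend_sphere (triv k.+1 (g (apex R k)) (leqnn _)) cg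
  (@cst_continuous _ _ (g (apex R k))) erefl erefl.
exists (fun p => \val (Phi p)); split=> //.
  by apply: within_continuous_postcomp cPhi _; exact: continuous_set_val.
by move=> p bp; rewrite Phig // -gphi.
Qed.

(** In a small ball the extension lands in a ball of radius [e / 2] around [y],
    which makes it close to any map into that ball. *)
Lemma extends_near_small m d (X : pseudoMetricType R) (e : R) (y : X) :
  locally_m_connected R m X -> (d <= m)%N -> 0 < e ->
  exists2 eta : R, 0 < eta & forall F : 'rV[R]_d.+1 -> X,
    (forall p, cube R d.+1 p -> ball y eta (F p)) ->
    extends_near (fun z z' => ball z e z') F.
Proof.
move=> lc dm e_gt0.
have e2 : 0 < e / 2 by lra.
have [V [VU [nV triv]]] := lc y (ball y (e / 2)) (nbhsx_ballx _ _ e2).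
have /nbhs_ballP[r /= r_gt0 rV] := nV.
have r2 : 0 < r / 2 by lra.
exists (Num.min (r / 2) (e / 2)); first by rewrite lt_min r2.
move=> F Fy; exists (r / 2) => // phi cphi nphi.
have [||Phi [cPhi ePhi PhiU]] := @extend_trivial_incl d X V _ VU phi _ cphi.
- by move=> j v jd; apply: triv; exact: leq_trans jd dm.
- move=> p bp; apply: rV; apply: ball_split (nphi p bp).
  by apply: le_ball (Fy p bp.1); rewrite ge_min lexx.
exists Phi; split=> // p cp; apply: ball_splitr (PhiU p).
by apply: le_ball (Fy p cp); rewrite ge_min lexx orbT.
Qed.

(** Induction on the dimension: the walls that bisection needs are cubes of the
    previous dimension. *)
Lemma extends_near_controlled m d (X : pseudoMetricType R) (F : 'rV[R]_d -> X)
    (e : R) :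
  locally_m_connected R m X -> (d <= m.+1)%N -> continuous F -> 0 < e ->
  extends_near (fun z z' => ball z e z') F.
Proof.
move=> lc; elim: d F e => [|d IH] F e dm cF e_gt0.
  exists 1 => // phi _ _; exists F; split=> //.
  - exact: continuous_subspaceT.
  - by move=> p [_ [[]]].
  - by move=> p _; exact: ballxx.
apply: extends_near_local cF => [G cG e' e'_gt0|y].
  by apply: IH => //; exact: ltnW.
exact: (extends_near_small y lc).
Qed.

(** In the top dimension only some extension is asked for. Semilocal
    connectedness speaks of loops based at the centre [y], so that a path from
    [y] to the sphere is needed, which local connectedness provides. *)
Lemma extends_near_small_top k (X : pseudoMetricType R) (y : X) :
  locally_m_connected R k X -> semilocally_n_connected R k.+1 X ->
  exists2 eta : R, 0 < eta & forall F : 'rV[R]_k.+2 -> X,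
    (forall p, cube R k.+2 p -> ball y eta (F p)) ->
    extends_near (fun _ _ => True) F.
Proof.
move=> lc slc; have [U [Uy [oU trivU]]] := slc y.
have [V [VU [nV trivV]]] := lc y U (open_nbhs_nbhs (conj oU (set_mem Uy))).
have /nbhs_ballP[r /= r_gt0 rV] := nV.
have r2 : 0 < r / 2 by lra.
exists (r / 2) => // F Fy; exists (r / 2) => // phi cphi nphi.
have phiV p : bdry p -> V (phi p).
  by move=> bp; apply: rV; exact: ball_split (Fy p bp.1) (nphi p bp).
have b_apex : bdry (apex R k).
  by apply: cone_base => j; rewrite mxE lexx ler01.
have [g [cg gphi]] := within_continuous_lift (exist _ y Uy : U) cphi
  (fun p bp => VU _ (phiV p bp)).
have Vy : y \in V := mem_set (nbhs_singleton nV).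
have [gamma [cgamma gamma0 gamma1]] := path_of_trivial_pi0
  (exist (fun z => z \in V) _ (mem_set (phiV _ b_apex)) : V)
  (trivV 0%N (exist _ y Vy : V) isT).
have [||Phi [cPhi ePhi]] := extend_sphere trivU cg cgamma.
- by rewrite gamma0; apply: val_inj; rewrite gphi.
- by rewrite gamma1; exact: val_inj.
by exists Phi; split=> // p bp; rewrite ePhi // gphi.
Qed.

Lemma extends_near_top k (X : pseudoMetricType R) (F : 'rV[R]_k.+2 -> X) :
  locally_m_connected R k X -> semilocally_n_connected R k.+1 X ->
  continuous F -> extends_near (fun _ _ => True) F.
Proof.
move=> lc slc cF; apply: extends_near_local cF => [G cG e e_gt0|y].
  exact: (extends_near_controlled lc).
exact: extends_near_small_top.
Qed.

Lemma nloop_retr_continuous n (X : topologicalType) (x : X) (f : nloop R n x) :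
  continuous (fun u : 'rV[R]_n => f (cube_retr u)).
Proof.
apply: continuous_composed; first exact: cube_retr_continuous.
exact: nloop_continuous.
Qed.

(** A homotopy from [f] to [g] is an extension over the cube of a map on its
    boundary which is close to the constant homotopy of [f] when [g] is close to
    [f]. *)
Lemma near_homotopic k (X : pseudoMetricType R) (x : X) (f : nloop R k.+1 x) :
  locally_m_connected R k X -> semilocally_n_connected R k.+1 X ->
  exists2 delta : R, 0 < delta & forall g : nloop R k.+1 x,
    (forall u, ball (f u) delta (g u)) -> homotopic f g.
Proof.
move=> lc slc.
pose F (p : 'rV[R]_k.+2) := f (cube_retr (del ord0 p)).
have cF : continuous F.
  apply: (@continuous_composed _ _ _ (del ord0) (fun u => f (cube_retr u))).
    exact: del_continuous.
  exact: nloop_retr_continuous.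
have [delta delta_gt0 ext] := extends_near_top lc slc cF.
exists delta => // g fg.
pose w (u : 'rV[R]_k.+1) := g (cube_retr u).
have f_bdry u : bdry u -> f (cube_retr u) = x.
  by move=> /cube_boundary_retr; exact: nloop_boundary.
have g_bdry u : bdry u -> g (cube_retr u) = x.
  by move=> /cube_boundary_retr; exact: nloop_boundary.
have [||Phi [cPhi ePhi _]] := ext (replace_face ord0 1 w F).
- apply: replace_face_continuous; first by right.
  + by apply: continuous_subspaceT; exact: nloop_retr_continuous.
  + exact: continuous_subspaceT.
  + by move=> p _ _ bp; rewrite /w /F f_bdry // g_bdry.
- move=> p _; rewrite /replace_face; case: ifP => _; first exact: fg.
  exact: ballxx.
have cube_tu (t : unit_itv R) (u : cube R k.+1) :
  cube R k.+2 (ins ord0 (\val t) (\val u)).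
  by apply/cube_ins; split; [exact: val_itv|exact: val_cube].
have F_tu t (u : cube R k.+1) : F (ins ord0 t (\val u)) = f u.
  by rewrite /F insK val_cubeK.
have w_u (u : cube R k.+1) : w (\val u) = g u by rewrite /w val_cubeK.
exists (fun tu => Phi (ins ord0 (\val tu.1) (\val tu.2))); split.
- apply: (within_continuous_total cPhi); last by move=> -[t u]; exact: cube_tu.
  apply: ins_continuous.
    apply: (@continuous_composed _ _ _ fst (fun t : unit_itv R => \val t)).
      by move=> ?; exact: cvg_fst.
    exact: continuous_set_val.
  apply: (@continuous_composed _ _ _ snd (fun u : cube R k.+1 => \val u)).
    by move=> ?; exact: cvg_snd.
  exact: continuous_set_val.
- move=> t u /= t0; rewrite ePhi.
    by rewrite /replace_face ins_at t0 eq_sym oner_eq0 F_tu.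
  by apply/bdry_ins; split; [exact: val_itv|exact: val_cube|left].
- move=> t u /= t1; rewrite ePhi.
    by rewrite /replace_face ins_at t1 eqxx insK w_u.
  by apply/bdry_ins; split; [exact: val_itv|exact: val_cube|right; left].
- move=> t u bu /=; have bvu := (cube_boundary_bdry u).1 bu.
  rewrite ePhi.
    rewrite /replace_face insK w_u F_tu.
    by case: ifP => _; exact: nloop_boundary.
  by apply/bdry_ins; split; [exact: val_itv|exact: val_cube|right; right].
Qed.

End local_extension.

(** * Countably many loops up to small perturbation *)

Section countability.
Variables (R : realType) (X : pseudoMetricType R).

Lemma dense_sequence (x : X) : separable X ->
  exists s : nat -> X, forall y (e : R), 0 < e -> exists i, ball (s i) e y.
Proof.
move=> [D /countable_injP[f finj] dD].
have /choice[s sP] : forall i : nat, exists d : X,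
    (exists2 d', D d' & f d' = i) -> D d /\ f d = i.
  move=> i; have [[d Dd fd]|no] := pselect (exists2 d', D d' & f d' = i).
    by exists d.
  by exists x.
exists s => y e e_gt0.
have [||d [yd Dd]] := dD (ball y e)°.
- by exists y; exact: nbhsx_ballx.
- exact: open_interior.
exists (f d); have [|Ds fs] := sP (f d); first by exists d.
have -> : s (f d) = d by apply: finj => //; exact/mem_set.
by apply: ball_sym; exact: (interior_subset yd).
Qed.

Lemma unif_cont n (h : 'rV[R]_n -> X) (e : R) : continuous h -> 0 < e ->
  exists2 r : R, 0 < r & forall u v, cube R n u -> ball u r v ->
    ball (h u) e (h v).
Proof.
move=> ch e_gt0; have e2 : 0 < e / 2 by lra.
pose P (r : R) (q : 'rV[R]_n) := forall v, ball q r v -> ball (h q) e (h v).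
suff [r r_gt0 rP] : exists2 r : R, 0 < r & forall q, cube R n q -> P r q.
  by exists r => // u v cu; exact: rP.
apply: cube_uniform_radius => p _.
have /nbhs_ballP[rho /= rho_gt0 rhoP] :
  nbhs p (h @^-1` ball (h p) (e / 2)) by apply: ch; exact: nbhsx_ballx.
exists (rho / 2) => [|q r pq /andP[r0 r_lt] v qv]; first by lra.
apply: ball_splitr.
  by apply: rhoP; apply: le_ball pq; lra.
by apply: rhoP; apply: (ball_split pq); apply: le_ball qv; exact: ltW.
Qed.

(** [inord] is exact on the values met here, since [N * u_j <= N]. *)
Definition cell N n (u : 'rV[R]_n) : {ffun 'I_n -> 'I_N.+1} :=
  [ffun j => inord (Num.truncn (N%:R * u ord0 j))].

Lemma cell_close N n (u v : 'rV[R]_n) (r : R) :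
  0 < r -> r^-1 < N%:R -> cube R n u -> cube R n v ->
  cell N u = cell N v -> ball u r v.
Proof.
move=> r_gt0 Nr cu cv uv; split=> // i j; rewrite ord1.
have N_gt0 : (0 : R) < N%:R by apply: lt_trans Nr; rewrite invr_gt0.
have trunc_lt (w : 'rV[R]_n) : cube R n w ->
    (Num.truncn (N%:R * w ord0 j) < N.+1)%N.
  move=> cw; rewrite ltnS truncn_le_nat; have /andP[_ w1] := cw j.
  apply: (@le_lt_trans _ _ N%:R); last by rewrite ltr_nat.
  by rewrite ler_piMr // ltW.
have /(congr1 val) : cell N u j = cell N v j by rewrite uv.
rewrite !ffunE /= !inordK ?trunc_lt // => tuv.
have /andP[u0 _] := cu j; have /andP[v0 _] := cv j.
have /truncn_itv/andP[u1 u2] : 0 <= N%:R * u ord0 j by rewrite mulr_ge0 // ltW.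
have /truncn_itv/andP[v1 v2] : 0 <= N%:R * v ord0 j by rewrite mulr_ge0 // ltW.
rewrite -tuv -natr1 in v1 v2; rewrite -natr1 in u2.
have Nr1 : 1 < N%:R * r by rewrite -ltr_pdivrMr // div1r.
rewrite /ball /= ltr_norml; apply/andP.
by split; rewrite -(ltr_pM2l N_gt0); lra.
Qed.

(** A mesh together with the index, in a dense sequence, of an approximate value
    on each cell of the grid: a countable type. *)
Definition code n := {N : nat & {ffun {ffun 'I_n -> 'I_N.+1} -> nat}}.

Definition near_code n (s : nat -> X) (e : R) (h : 'rV[R]_n -> X)
    (c : code n) :=
  forall u, cube R n u -> ball (s (tagged c (cell (tag c) u))) e (h u).

Lemma near_code_exists n (s : nat -> X) (e : R) (h : 'rV[R]_n -> X) :
  (forall y (e : R), 0 < e -> exists i, ball (s i) e y) ->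
  continuous h -> 0 < e -> exists c : code n, near_code s e h c.
Proof.
move=> sP ch e_gt0; have e2 : 0 < e / 2 by lra.
have [r r_gt0 rP] := unif_cont ch e2.
pose N := Num.bound r^-1.
have /choice[w wP] : forall a : {ffun 'I_n -> 'I_N.+1}, exists i : nat,
    forall u, cube R n u -> cell N u = a -> ball (s i) e (h u).
  move=> a.
  have [[u [cu ua]]|no] := pselect (exists u, cube R n u /\ cell N u = a).
    have [i si] := sP (h u) _ e2; exists i => v cv va; apply: (ball_split si).
    apply: rP => //; apply: (@cell_close N) => //; last by rewrite ua va.
    by apply: archi_boundP; rewrite invr_ge0 ltW.
  by exists 0%N => u cu ua; case: no; exists u.
exists (Tagged (fun N => {ffun {ffun 'I_n -> 'I_N.+1} -> nat}) [ffun a => w a]).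
by move=> u cu /=; rewrite ffunE; exact: wP.
Qed.

End countability.

Theorem theorem3p2 (R : realType) (n : nat) (X : metricType R) (x : X) :
  (1 <= n)%N ->
  m_connected R n.-1 X ->
  locally_m_connected R n.-1 X ->
  semilocally_n_connected R n X ->
  separable X ->
  countable [set: homotopy_group R n x].
Proof.
case: n => [//|k] _ _ lc slc /(dense_sequence x)[s sP].
pose total (f : nloop R k.+1 x) (u : 'rV[R]_k.+1) := f (cube_retr u).
have /choice[c cP] : forall q : homotopy_group R k.+1 x,
    exists mc : nat * code k.+1,
      near_code s (mc.1.+1%:R^-1 : R) (total (repr q)) mc.2 /\
      forall g : nloop R k.+1 x,
        near_code s (mc.1.+1%:R^-1 : R) (total g) mc.2 -> homotopic (repr q) g.
  move=> q; have [delta delta_gt0 nearP] := near_homotopic (repr q) lc slc.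
  (* Two loops with the same code differ by at most twice its error. *)
  pose m := Num.bound (delta / 2)^-1.
  have m_gt0 : (0 : R) < m.+1%:R^-1 by rewrite invr_gt0.
  have [c cq] :=
    near_code_exists sP (@nloop_retr_continuous R _ _ x (repr q)) m_gt0.
  exists (m, c); split=> // g cg; apply: nearP => u.
  have := cg _ (val_cube u); have := cq _ (val_cube u).
  rewrite /total val_cubeK => qu gu.
  apply: (le_ball _ (ball_triangle (ball_sym qu) gu)).
  have : m.+1%:R^-1 <= delta / 2.
    rewrite -[leRHS]invrK lef_pV2 ?posrE ?invr_gt0 ?divr_gt0 //.
    apply/ltW/(lt_le_trans (archi_boundP _)).
      by rewrite invr_ge0 ltW // divr_gt0.
    by rewrite ler_nat.
  by move=> ?; rewrite [leRHS]splitr lerD.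
apply/countable_injP; exists (pickle \o c) => q q' _ _.
move=> /(pcan_inj (@pickleK _)) e.
rewrite -[q]reprK -[q']reprK; apply/homotopy_group_eqP.
by apply: (cP q).2; rewrite e; exact: (cP q').1.
Qed.
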